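(* Let $\mathfrak{X}$ be an abstract state space, $(\mathcal{U}(t))_{t\ge0}$ a substochastic $C_0$-semigroup on $\mathfrak{X}$ with generator $\mathcal{A}$, $\mathcal{B}:\mathscr{D}(\mathcal{A})\to\mathfrak{X}$ a positive linear operator with $\langle\mathbf{\Psi},(\mathcal{A}+\mathcal{B})u\rangle\le0$ for all $u\in\mathscr{D}(\mathcal{A})\cap\mathfrak{X}_+$, and let $(\mathcal{V}(t))_{t\ge0}$ be the associated minimal semigroup, with generator $\mathcal{G}$. Let $\mathcal{H}=\{u\in\mathfrak{X}_+:\langle\mathbf{\Xi}_\lambda,u\rangle=0\text{ for any }\lambda>0\}$ and $\mathscr{H}=\mathcal{H}-\mathcal{H}$. Then $\mathcal{H}$ is a closed hereditary subcone of $\mathfrak{X}_+$, and $\mathscr{H}$ is an order ideal of $\mathfrak{X}$ with induced positive cone $\mathscr{H}_+=\mathscr{H}\cap\mathfrak{X}_+$ equal to $\mathcal{H}$. Moreover, $\mathscr{H}$ is invariant under $(\mathcal{V}(t))_{t\ge0}$.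
   Context: An abstract state space is a real ordered Banach space $\mathfrak{X}$ whose positive cone $\mathfrak{X}_+$ is closed, generating ($\mathfrak{X}=\mathfrak{X}_+-\mathfrak{X}_+$), and on which the norm is additive: $\|u+v\|=\|u\|+\|v\|$ for $u,v\in\mathfrak{X}_+$. $\mathbf{\Psi}\in\mathfrak{X}^\star_+$ is the positive functional with $\langle\mathbf{\Psi},u\rangle=\|u\|$ for $u\in\mathfrak{X}_+$. A linear operator is positive if it maps positive elements of its domain into $\mathfrak{X}_+$. A $C_0$-semigroup $(T(t))_{t\ge0}$ is substochastic if each $T(t)$ is positive and $\|T(t)u\|\le\|u\|$ for $u\in\mathfrak{X}_+$. Minimal semigroup: under the stated hypotheses there is a smallest (for the operator order, for each $t$) substochastic $C_0$-semigroup $(\mathcal{V}(t))_{t\ge0}$ whose generator $\mathcal{G}$ extends $(\mathcal{A}+\mathcal{B},\mathscr{D}(\mathcal{A}))$; it satisfies $(\lambda-\mathcal{G})^{-1}u=\lim_{n\to\infty}(\lambda-\mathcal{A})^{-1}\sum_{k=0}^n[\mathcal{B}(\lambda-\mathcal{A})^{-1}]^ku$ for all $\lambda>0$, $u\in\mathfrak{X}$. Functionals: $\mathfrak{a}_0(u)=-\langle\mathbf{\Psi},\mathcal{G}u\rangle$ for $u\in\mathscr{D}(\mathcal{G})$; $\mathfrak{a}$ is its restriction to $\mathscr{D}(\mathcal{A})$, i.e. $\mathfrak{a}(u)=-\langle\mathbf{\Psi},\mathcal{A}u+\mathcal{B}u\rangle$; and $\overline{\mathfrak{a}}:\mathscr{D}(\mathcal{G})\to\mathbb{R}$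 is the linear functional defined by $\overline{\mathfrak{a}}((\lambda-\mathcal{G})^{-1}u)=\sum_{n=0}^\infty\mathfrak{a}\big((\lambda-\mathcal{A})^{-1}[\mathcal{B}(\lambda-\mathcal{A})^{-1}]^nu\big)$, $u\in\mathfrak{X}$, where the series converges and the resulting functional does not depend on $\lambda>0$. For $\lambda>0$, $\mathbf{\Xi}_\lambda\in\mathfrak{X}^\star$ is defined by $\langle\mathbf{\Xi}_\lambda,u\rangle=\mathfrak{a}_0((\lambda-\mathcal{G})^{-1}u)-\overline{\mathfrak{a}}((\lambda-\mathcal{G})^{-1}u)$, $u\in\mathfrak{X}$. A subcone $\mathcal{C}$ of $\mathfrak{X}_+$ is hereditary if $0\le u\le v$ and $v\in\mathcal{C}$ imply $u\in\mathcal{C}$. An order ideal of $\mathfrak{X}$ is a linear subspace $\mathscr{A}$ such that $u_1\le v\le u_2$ with $u_1,u_2\in\mathscr{A}$ implies $v\in\mathscr{A}$. *)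

(* Defs.v *)
From Stdlib Require Import Reals.
From Coquelicot Require Import Coquelicot.
Open Scope R_scope.

Set Implicit Arguments.
Unset Strict Implicit.
Unset Printing Implicit Defensive.

Notation RBanach := (CompleteNormedModule R_AbsRing).

(** * Cones and order *)

Definition is_cone (X : RBanach) (C : X -> Prop) : Prop :=
  C zero /\
  (forall u v : X, C u -> C v -> C (plus u v)) /\
  (forall (c : R) (u : X), 0 <= c -> C u -> C (scal c u)).

Definition ole (X : RBanach) (P : X -> Prop) (u v : X) : Prop := P (minus v u).

Record is_abstract_state_space (X : RBanach) (P : X -> Prop) : Prop := {
  ass_cone : is_cone P;
  ass_proper : forall u : X, P u -> P (opp u) -> u = zero;
  ass_closed : closed P;
  ass_generating : forall u : X, exists v w : X, P v /\ P w /\ u = minus v w;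
  ass_norm_additive :
    forall u v : X, P u -> P v -> norm (plus u v) = norm u + norm v
}.

(* On an abstract state space these conditions determine [Psi] uniquely. *)
Definition is_norm_functional (X : RBanach) (P : X -> Prop) (Psi : X -> R)
  : Prop :=
  is_linear (V := R_NormedModule) Psi /\ forall u : X, P u -> Psi u = norm u.

Definition is_subcone (X : RBanach) (P C : X -> Prop) : Prop :=
  is_cone C /\ forall u : X, C u -> P u.

Definition is_hereditary (X : RBanach) (P C : X -> Prop) : Prop :=
  forall u v : X, ole P zero u -> ole P u v -> C v -> C u.

Definition is_subspace (X : RBanach) (S : X -> Prop) : Prop :=
  S zero /\
  (forall u v : X, S u -> S v -> S (plus u v)) /\
  (forall (c : R) (u : X), S u -> S (scal c u)).

Definition is_order_ideal (X : RBanach) (P S : X -> Prop) : Prop :=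
  is_subspace S /\
  forall u1 u2 v : X, S u1 -> S u2 -> ole P u1 v -> ole P v u2 -> S v.

(** * Semigroups, generators, resolvents *)

(* A semigroup is a map on all of [R]; only its values at [t >= 0] matter. *)
Record is_C0_semigroup (X : RBanach) (T : R -> X -> X) : Prop := {
  sg_bounded_linear : forall t : R, 0 <= t -> is_linear (T t);
  sg_zero : forall u : X, T 0 u = u;
  sg_add : forall s t : R, 0 <= s -> 0 <= t ->
    forall u : X, T (s + t) u = T s (T t u);
  sg_continuous : forall u : X,
    filterlim (fun t : R => T t u) (at_right 0) (locally u)
}.

Record is_substochastic (X : RBanach) (P : X -> Prop) (T : R -> X -> X)
  : Prop := {
  sub_C0 : is_C0_semigroup T;
  sub_positive : forall t : R, 0 <= t -> forall u : X, P u -> P (T t u);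
  sub_contractive : forall t : R, 0 <= t ->
    forall u : X, P u -> norm (T t u) <= norm u
}.

Definition is_gen (X : RBanach) (T : R -> X -> X) (u v : X) : Prop :=
  filterlim (fun h : R => scal (/ h) (minus (T h u) u)) (at_right 0)
    (locally v).

Definition gen_dom (X : RBanach) (T : R -> X -> X) (u : X) : Prop :=
  exists v : X, is_gen T u v.

(* Total function; meaningful only on [gen_dom T]. *)
Definition gen (X : RBanach) (T : R -> X -> X) (u : X) : X :=
  iota (fun v : X => is_gen T u v).

(* [resolvent T lambda] is (lambda - G)^{-1}, where G is the generator of T. *)
Definition resolvent (X : RBanach) (T : R -> X -> X) (lambda : R) (u : X) : X :=
  iota (fun w : X => gen_dom T w /\ minus (scal lambda w) (gen T w) = u).

(** * Positive perturbation and minimal semigroup *)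

(* [B] is an operator with domain [gen_dom U]; its values elsewhere are
   unconstrained and never used. *)
Record is_positive_operator_on (X : RBanach) (P D : X -> Prop) (B : X -> X)
  : Prop := {
  pos_op_plus : forall u v : X, D u -> D v -> B (plus u v) = plus (B u) (B v);
  pos_op_scal : forall (c : R) (u : X), D u -> B (scal c u) = scal c (B u);
  pos_op_positive : forall u : X, D u -> P u -> P (B u)
}.

Definition generator_extends (X : RBanach) (U : R -> X -> X) (B : X -> X)
  (T : R -> X -> X) : Prop :=
  forall u : X, gen_dom U u ->
    gen_dom T u /\ gen T u = plus (gen U u) (B u).

Definition is_minimal_semigroup (X : RBanach) (P : X -> Prop)
  (U : R -> X -> X) (B : X -> X) (V : R -> X -> X) : Prop :=
  is_substochastic P V /\
  generator_extends U B V /\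
  forall W : R -> X -> X,
    is_substochastic P W -> generator_extends U B W ->
    forall t : R, 0 <= t -> forall u : X, P u -> ole P (V t u) (W t u).

(** * Functionals *)

Definition a0 (X : RBanach) (Psi : X -> R) (V : R -> X -> X) (u : X) : R :=
  - Psi (gen V u).

Definition afun (X : RBanach) (Psi : X -> R) (U : R -> X -> X) (B : X -> X)
  (u : X) : R :=
  - Psi (plus (gen U u) (B u)).

(* The functional on [gen_dom V] sending (lambda - G)^{-1} u to
   sum_n afun ((lambda - A)^{-1} [B (lambda - A)^{-1}]^n u), A and G being the
   generators of U and V: here u is recovered from w as lambda w - G w.
   That the series converges with a sum independent of [lambda > 0] is a
   theorem, not part of the definition, so [lambda] is kept as a parameter. *)
Definition abar (X : RBanach) (Psi : X -> R) (U : R -> X -> X) (B : X -> X)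
  (V : R -> X -> X) (lambda : R) (w : X) : R :=
  let u := minus (scal lambda w) (gen V w) in
  Series (fun n : nat =>
    afun Psi U B
      (resolvent U lambda
         (Nat.iter n (fun x : X => B (resolvent U lambda x)) u))).

Definition Xi (X : RBanach) (Psi : X -> R) (U : R -> X -> X) (B : X -> X)
  (V : R -> X -> X) (lambda : R) (u : X) : R :=
  a0 Psi V (resolvent V lambda u)
  - abar Psi U B V lambda (resolvent V lambda u).

Definition Hcone (X : RBanach) (P : X -> Prop) (Psi : X -> R)
  (U : R -> X -> X) (B : X -> X) (V : R -> X -> X) (u : X) : Prop :=
  P u /\ forall lambda : R, 0 < lambda -> Xi Psi U B V lambda u = 0.

Definition cone_diff (X : RBanach) (C : X -> Prop) (u : X) : Prop :=
  exists v w : X, C v /\ C w /\ u = minus v w.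

(* Main.v *)
Require Import Defs.
From Stdlib Require Import Reals ZArith Lra Lia List Classical IndefiniteDescription.
From Coquelicot Require Import Coquelicot.
Open Scope R_scope.

Set Implicit Arguments.
Unset Strict Implicit.
Unset Printing Implicit Defensive.

(* With [L_l = (l - A)^{-1}] and [K_l = B L_l], the series
   [S_l = sum_n L_l K_l^n] is a substochastic pseudo-resolvent, so that
   [W(t) = lim_n J_n^(floor(t 2^n))], where [J_n = 2^n S_(2^n)], is a
   substochastic semigroup whose generator extends [A + B]. Minimality gives
   [V <= W], hence [(l - G)^{-1} <= S_l]; the reverse inequality comes from
   iterating [(l - G)^{-1} = L_l + (l - G)^{-1} K_l]. Therefore the functional
   [Xi_l] equals [lim_n <Psi, K_l^n u>], which is positive and bounded, and
   the null cone is closed and hereditary. For [l < m] it satisfies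
   [Xi_m <= Xi_l] and [(m - l) Xi_l (S_m u) <= Xi_l u] on the cone, so the null
   cone is invariant under [S_m], then under [W], and by heredity under [V].

   Boundedness of positive operators uses a Baire argument: every [u] is
   [v - w] with [v, w >= 0] and [|v| + |w| <= M |u|] for a fixed [M]. *)

(** * Linear identities in modules, by reflection *)

(** Minimality only compares [V] with other semigroups, and the series for its resolvent has to be
    proved. This calls for a competitor whose resolvent is exactly [S_l], hence for a generation
    theorem. Since [K_l] is merely a contraction on the cone, [sum K_l^n] may diverge; the mass
    balance [l |L_l u| + |K_l u| <= |u|], which is [hAB] read at [L_l u], bounds the partial sums
    once [L_l] is applied. What escapes this balance is [lim |K_l^n u|]: because [a(L_l v) = <Psi,
    v> - <Psi, K_l v> - l <Psi, L_l v>], the series in [abar] telescopes and misses [a0] by exactly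
    this limit. Norm estimates are exact on the cone only. The constant [M] carries them to the
    whole space, and a composite operator pays it only once, since contractions on the cone are
    stable under composition. Laplace integrals are replaced by geometric sums on dyadic meshes, and
    the exponential formula by implicit Euler steps of halved size, so that all limits are limits of
    sequences. *)

Inductive vexp :=
| Vvar (n : nat) | Vzero | Vplus (a b : vexp) | Vopp (a : vexp)
| Vscal (r : R) (a : vexp).

Fixpoint vcoef (e : vexp) (i : nat) : R :=
  match e with
  | Vvar n => if Nat.eqb n i then 1 else 0
  | Vzero => 0
  | Vplus a b => vcoef a i + vcoef b i
  | Vopp a => - vcoef a i
  | Vscal r a => r * vcoef a i
  end.

Fixpoint veq (e1 e2 : vexp) (n i : nat) : Prop :=
  match n with
  | O => True
  | S m => vcoef e1 i = vcoef e2 i /\ veq e1 e2 m (S i)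
  end.

Section Reflection.
Context (X : RBanach).

Fixpoint veval (env : list X) (e : vexp) : X :=
  match e with
  | Vvar n => nth n env zero
  | Vzero => zero
  | Vplus a b => plus (veval env a) (veval env b)
  | Vopp a => opp (veval env a)
  | Vscal r a => scal r (veval env a)
  end.

Fixpoint vsum (f : nat -> R) (env : list X) (i : nat) : X :=
  match env with
  | nil => zero
  | x :: env' => plus (scal (f i) x) (vsum f env' (S i))
  end.

Lemma vsum_ext (f g : nat -> R) (env : list X) (i : nat) :
  (forall j, (i <= j < i + length env)%nat -> f j = g j) ->
  vsum f env i = vsum g env i.
Proof.
  revert i; induction env as [|x env IH]; intros i H; simpl; trivial.
  rewrite (H i) by (simpl; lia). f_equal. apply IH. intros j Hj. apply H. simpl; lia.
Qed.

Lemma vsum_zero (env : list X) (i : nat) : vsum (fun _ => 0) env i = zero.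
Proof.
  revert i; induction env as [|x env IH]; intros i; simpl; trivial.
  rewrite IH, plus_zero_r. exact (scal_zero_l x).
Qed.

Lemma vsum_plus (f g : nat -> R) (env : list X) (i : nat) :
  vsum (fun j => f j + g j) env i = plus (vsum f env i) (vsum g env i).
Proof.
  revert i; induction env as [|x env IH]; intros i; simpl.
  - now rewrite plus_zero_l.
  - rewrite IH.
    replace (scal (f i + g i) x) with (plus (scal (f i) x) (scal (g i) x))
      by (symmetry; exact (scal_distr_r (f i) (g i) x)).
    rewrite <- !plus_assoc. f_equal. rewrite !plus_assoc. f_equal. apply plus_comm.
Qed.

Lemma vsum_scal (r : R) (f : nat -> R) (env : list X) (i : nat) :
  vsum (fun j => r * f j) env i = scal r (vsum f env i).
Proof.
  revert i; induction env as [|x env IH]; intros i; simpl.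
  - symmetry; exact (scal_zero_r r).
  - rewrite IH. rewrite scal_distr_l. f_equal. symmetry; exact (scal_assoc r (f i) x).
Qed.

Lemma vsum_var (n : nat) (env : list X) (i : nat) :
  vsum (fun j => if Nat.eqb (i + n) j then 1 else 0) env i = nth n env zero.
Proof.
  revert n i; induction env as [|x env IH]; intros n i; simpl.
  - now destruct n.
  - destruct n as [|n].
    + rewrite Nat.add_0_r, Nat.eqb_refl.
      rewrite (vsum_ext (g := fun _ => 0)).
      * rewrite vsum_zero, plus_zero_r. exact (scal_one x).
      * intros j Hj. destruct (Nat.eqb_spec i j); trivial. lia.
    + destruct (Nat.eqb_spec (i + S n) i); [lia|].
      rewrite (scal_zero_l x : scal 0 x = zero), plus_zero_l.
      rewrite <- (IH n (S i)). apply vsum_ext. intros j _.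
      now replace (i + S n)%nat with (S i + n)%nat by lia.
Qed.

Lemma veval_vsum (env : list X) (e : vexp) : veval env e = vsum (vcoef e) env 0.
Proof.
  induction e as [n| |a IHa b IHb|a IHa|r a IHa]; simpl.
  - symmetry. exact (vsum_var n env 0).
  - symmetry. apply vsum_zero.
  - rewrite vsum_plus. congruence.
  - rewrite (vsum_ext (g := fun j => (-1) * vcoef a j)) by (intros; ring).
    rewrite vsum_scal, IHa. symmetry; exact (scal_opp_one _).
  - rewrite vsum_scal. congruence.
Qed.

Lemma veq_correct (env : list X) (e1 e2 : vexp) :
  veq e1 e2 (length env) 0 -> veval env e1 = veval env e2.
Proof.
  rewrite !veval_vsum. generalize 0%nat.
  induction env as [|x env IH]; intros i; simpl; trivial.
  intros [-> H]. now rewrite (IH _ H).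
Qed.

End Reflection.

(** The dummy [match] forces [constr_eq] to run while a term is being computed; atoms are thus
    identified syntactically. *)
Ltac vec_mem x l :=
  match l with
  | ?y :: _ => let _ := match constr:(Set) with _ => constr_eq x y end in true
  | _ :: ?m => vec_mem x m
  | nil => false
  end.

Ltac vec_atoms e l :=
  lazymatch e with
  | plus ?a ?b => let l := vec_atoms a l in vec_atoms b l
  | minus ?a ?b => let l := vec_atoms a l in vec_atoms b l
  | opp ?a => vec_atoms a l
  | scal _ ?a => vec_atoms a l
  | zero => l
  | _ => match vec_mem e l with true => l | false => constr:(cons e l) end
  end.

Ltac vec_index x l :=
  match l with
  | ?y :: _ => let _ := match constr:(Set) with _ => constr_eq x y end in constr:(O)
  | _ :: ?m => let n := vec_index x m in constr:(S n)
  end.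

Ltac vec_reify e l :=
  lazymatch e with
  | plus ?a ?b =>
      let a := vec_reify a l in let b := vec_reify b l in constr:(Vplus a b)
  | minus ?a ?b =>
      let a := vec_reify a l in let b := vec_reify b l in constr:(Vplus a (Vopp b))
  | opp ?a => let a := vec_reify a l in constr:(Vopp a)
  | scal ?r ?a => let a := vec_reify a l in constr:(Vscal r a)
  | zero => constr:(Vzero)
  | _ => let n := vec_index e l in constr:(Vvar n)
  end.

Ltac vec_start :=
  lazymatch goal with
  | |- @eq ?T ?a ?b =>
      let l := vec_atoms a (@nil T) in
      let l := vec_atoms b l in
      let ea := vec_reify a l in
      let eb := vec_reify b l in
      refine (@veq_correct _ l ea eb _);
      cbn [veq vcoef Nat.eqb length]
  end.

(** One real equation per atom is produced. Those that [ring] cannot close, typically because of an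
    inverse, are left to the caller for [field]. *)
Ltac vec := vec_start; repeat split; try ring.


(* Canonical structure inference elaborates [plus (minus u v) w] and
   [plus u w] through different paths; these abbreviations fix one path, so
   that rewriting is syntactic. *)
Module VectorOperations.
Notation zero := (@zero (CompleteNormedModule.AbelianMonoid R_AbsRing _)) (only parsing).
Notation plus := (@plus (CompleteNormedModule.AbelianMonoid R_AbsRing _)) (only parsing).
Notation minus := (@minus (CompleteNormedModule.AbelianGroup R_AbsRing _)) (only parsing).
Notation opp := (@opp (CompleteNormedModule.AbelianGroup R_AbsRing _)) (only parsing).
Notation scal := (@scal R_Ring (CompleteNormedModule.ModuleSpace R_AbsRing _)) (only parsing).
Notation norm := (@norm R_AbsRing (CompleteNormedModule.NormedModule R_AbsRing _)) (only parsing).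
End VectorOperations.

(** * Limits of sequences *)

Notation tends x l := (filterlim x eventually (locally l)).

Section Limits.
Import VectorOperations.
Context (X : RBanach).
Implicit Types (x y : nat -> X) (u v w : X).

Lemma norm_scal_le (r : R) (u : X) : norm (scal r u) <= Rabs r * norm u.
Proof. exact (norm_scal r u). Qed.

(** The norm axiom for scalars is only an inequality; applying it also to [/ r] yields the reverse
    one. *)
Lemma norm_scal_nonneg (r : R) (u : X) : 0 <= r -> norm (scal r u) = r * norm u.
Proof.
  intros hr. apply Rle_antisym.
  - rewrite <- (Rabs_pos_eq r) at 2 by easy. apply norm_scal_le.
  - destruct (Req_dec r 0) as [->|hr0].
    + rewrite Rmult_0_l. exact (norm_ge_0 (scal 0 u)).
    + replace (norm u) with (norm (scal (/ r) (scal r u)))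
        by (f_equal; vec; now field).
      pose proof (norm_scal_le (/ r) (scal r u)) as h.
      assert (hi : 0 < / r) by (apply Rinv_0_lt_compat; lra).
      rewrite (Rabs_pos_eq (/ r)) in h by lra.
      apply (Rmult_le_compat_l r) in h; [|easy].
      replace (r * (/ r * norm (scal r u))) with (norm (scal r u)) in h
        by (field; lra).
      exact h.
Qed.

Lemma norm_plus_le (u v : X) : norm (plus u v) <= norm u + norm v.
Proof. exact (norm_triangle u v). Qed.

Lemma norm_minus_le (u v : X) : norm (minus u v) <= norm u + norm v.
Proof.
  rewrite <- (norm_opp v). exact (norm_triangle u (opp v)).
Qed.

Lemma norm_minus_sym (u v : X) : norm (minus u v) = norm (minus v u).
Proof. rewrite <- (norm_opp (minus v u)). f_equal. vec. Qed.

Lemma norm_minus_trans (v u w : X) :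
  norm (minus u w) <= norm (minus u v) + norm (minus v w).
Proof.
  replace (minus u w) with (plus (minus u v) (minus v w)) by vec.
  apply norm_plus_le.
Qed.

Lemma norm_of_zero : norm (zero : X) = 0.
Proof. exact (norm_zero (V := X)). Qed.

Lemma minus_self (u : X) : minus u u = zero.
Proof. vec. Qed.

Lemma filterlim_norm_eps {T : Type} (F : (T -> Prop) -> Prop) (HF : Filter F)
  (f : T -> X) (l : X) :
  filterlim f F (locally l) <->
  forall eps, 0 < eps -> F (fun t => norm (minus (f t) l) < eps).
Proof.
  split.
  - intros h eps he.
    exact (proj1 (filterlim_locally_ball_norm f l) h (mkposreal eps he)).
  - intros h. apply (proj2 (filterlim_locally_ball_norm f l)). intros [eps he]. now apply h.
Qed.

Lemma tends_eps x l :
  tends x l <->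
  forall eps, 0 < eps ->
    exists N, forall n, (N <= n)%nat -> norm (minus (x n) l) < eps.
Proof. exact (filterlim_norm_eps (filter_filter (F := eventually)) x l). Qed.

Lemma tends_norm x l : tends x l -> is_lim_seq (fun n => norm (minus (x n) l)) 0.
Proof.
  intros h. apply is_lim_seq_spec. intros eps.
  destruct (proj1 (tends_eps x l) h eps (cond_pos eps)) as [N hN].
  exists N. intros n hn. rewrite Rminus_0_r, Rabs_pos_eq by exact (norm_ge_0 (minus (x n) l)).
  now apply hN.
Qed.

Lemma tends_squeeze x l (e : nat -> R) :
  (forall n, norm (minus (x n) l) <= e n) -> is_lim_seq e 0 -> tends x l.
Proof.
  intros h he. apply tends_eps. intros eps heps.
  apply is_lim_seq_spec in he. destruct (he (mkposreal eps heps)) as [N hN].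
  exists N. intros n hn. specialize (hN n hn). simpl in hN.
  specialize (h n). rewrite Rminus_0_r in hN. apply Rabs_def2 in hN. lra.
Qed.

Lemma tends_unique x l l' : tends x l -> tends x l' -> l = l'.
Proof. exact (filterlim_locally_unique x l l'). Qed.

Lemma tends_const u : tends (fun _ => u) u.
Proof. apply filterlim_const. Qed.

Lemma tends_ext x y l : (forall n, x n = y n) -> tends x l -> tends y l.
Proof. intros h. now apply filterlim_ext. Qed.

Lemma tends_plus x y l l' : tends x l -> tends y l' ->
  tends (fun n => plus (x n) (y n)) (plus l l').
Proof.
  intros hx hy. exact (filterlim_comp_2 _ _ _ hx hy (filterlim_plus l l')).
Qed.

Lemma tends_scal r x l : tends x l -> tends (fun n => scal r (x n)) (scal r l).
Proof. intros hx. exact (filterlim_comp _ _ _ _ _ _ _ _ hx (filterlim_scal_r r l)). Qed.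

Lemma tends_minus x y l l' : tends x l -> tends y l' ->
  tends (fun n => minus (x n) (y n)) (minus l l').
Proof.
  intros hx hy. replace (minus l l') with (plus l (scal (-1) l')) by vec.
  apply (tends_ext (x := fun n => plus (x n) (scal (-1) (y n)))).
  - intros n. vec.
  - apply tends_plus; trivial. now apply tends_scal.
Qed.

Lemma tends_minus_zero u y : tends y zero -> tends (fun n => minus u (y n)) u.
Proof.
  intros hy. pose proof (tends_minus (@tends_const u) hy) as h.
  now replace (minus u zero) with u in h by vec.
Qed.

Lemma tends_S x l : tends x l -> tends (fun n => x (S n)) l.
Proof.
  rewrite !tends_eps. intros h eps he. destruct (h eps he) as [N hN].
  exists N. intros n hn. apply hN. lia.
Qed.

Lemma tends_bounded_map (F : X -> X) C x l :
  (forall u v, norm (minus (F u) (F v)) <= C * norm (minus u v)) ->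
  tends x l -> tends (fun n => F (x n)) (F l).
Proof.
  intros hF hx. apply tends_squeeze with (fun n => C * norm (minus (x n) l)).
  - intros n. apply hF.
  - replace (Finite 0) with (Rbar_mult C 0) by (simpl; f_equal; ring).
    apply is_lim_seq_scal_l. now apply tends_norm.
Qed.

Lemma tends_norm_le x l C : tends x l -> (forall n, norm (x n) <= C) -> norm l <= C.
Proof.
  intros h hC. apply le_epsilon. intros eps he.
  destruct (proj1 (tends_eps x l) h eps he) as [N hN].
  specialize (hN N (le_n _)). specialize (hC N).
  replace l with (minus (x N) (minus (x N) l)) by vec.
  pose proof (norm_minus_le (x N) (minus (x N) l)). lra.
Qed.

Lemma tends_minus_norm_le x l u C :
  tends x l -> (forall n, norm (minus (x n) u) <= C) -> norm (minus l u) <= C.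
Proof.
  intros h. apply tends_norm_le. apply tends_minus; [exact h | apply tends_const].
Qed.

Lemma closed_tends (D : X -> Prop) x l :
  closed D -> (forall n, D (x n)) -> tends x l -> D l.
Proof.
  intros hD hx hl. exact (closed_filterlim x D l hl hx hD).
Qed.

(** Coquelicot's [closed] is phrased with neighbourhoods. If [l] has no neighbourhood missing [D],
    choice picks points of [D] within [2^-n] of [l]. *)
Lemma tends_closed (D : X -> Prop) :
  (forall x l, (forall n, D (x n)) -> tends x l -> D l) -> closed D.
Proof.
  intros h l hl.
  assert (hx : forall n, exists u, D u /\ norm (minus u l) < (/ 2) ^ n).
  { intros n. apply NNPP. intros hno. apply hl.
    apply (locally_le_locally_norm l).
    assert (hp : 0 < (/ 2) ^ n) by (apply pow_lt; lra).
    exists (mkposreal _ hp). intros u hu hD. apply hno. now exists u. }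
  destruct (functional_choice _ hx) as [x hx'].
  apply (h x); [apply hx'|]. apply tends_squeeze with (fun n => 1 * (/ 2) ^ n).
  - intros n. rewrite Rmult_1_l. left. apply hx'.
  - replace (Finite 0) with (Rbar_mult 1 0) by (simpl; f_equal; ring).
    apply is_lim_seq_scal_l. apply is_lim_seq_geom. rewrite Rabs_pos_eq; lra.
Qed.

Lemma cauchy_tends x :
  (forall eps, 0 < eps -> exists N, forall n m, (N <= n)%nat -> (N <= m)%nat ->
     norm (minus (x n) (x m)) < eps) -> exists l, tends x l.
Proof.
  intros h. apply (proj1 (filterlim_locally_cauchy (U := X) (F := eventually) x)).
  intros [eps he].
  destruct (h eps he) as [N hN]. exists (fun n => (N <= n)%nat). split.
  - now exists N.
  - intros n m hn hm. exact (norm_compat1 (x n) (x m) eps (hN m n hm hn)).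
Qed.

Lemma cauchy_tends_tail x (e : nat -> R) :
  (forall n m, (n <= m)%nat -> norm (minus (x m) (x n)) <= e n) ->
  is_lim_seq e 0 -> exists l, tends x l.
Proof.
  intros h he. apply cauchy_tends. intros eps heps.
  apply is_lim_seq_spec in he.
  assert (h2 : 0 < eps / 2) by lra.
  destruct (he (mkposreal _ h2)) as [N hN]. exists N.
  assert (hN' : e N < eps / 2).
  { specialize (hN N (le_n _)). simpl in hN. rewrite Rminus_0_r in hN.
    apply Rabs_def2 in hN. lra. }
  intros n m hn hm. pose proof (norm_minus_trans (x N) (x n) (x m)).
  rewrite (norm_minus_sym (x N)) in H.
  pose proof (h N n hn). pose proof (h N m hm). lra.
Qed.

(** Being total, it lets limit operators be defined pointwise before convergence is established. *)
Definition vlim x : X := iota (fun l => tends x l).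

Lemma vlim_correct x : (exists l, tends x l) -> tends x (vlim x).
Proof.
  intros [l hl]. unfold vlim. apply (iota_correct (fun l => tends x l)).
  exists l. split; trivial. intros l'. now apply tends_unique.
Qed.

Lemma tends_geom (C q : R) : 0 <= q < 1 -> is_lim_seq (fun n => C * q ^ n) 0.
Proof.
  intros hq. replace (Finite 0) with (Rbar_mult C 0) by (simpl; f_equal; ring).
  apply is_lim_seq_scal_l. apply is_lim_seq_geom. rewrite Rabs_pos_eq; lra.
Qed.

End Limits.

Arguments tends_const {X} u.

(** * Generating closed cones *)

Section Cone.
Import VectorOperations.
Context (X : RBanach) (P : X -> Prop) (hX : is_abstract_state_space P).
Implicit Types (x y : nat -> X) (u v w : X).

Lemma cone_zero : P zero.
Proof. apply (ass_cone hX). Qed.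

Lemma cone_plus u v : P u -> P v -> P (plus u v).
Proof. apply (ass_cone hX). Qed.

Lemma cone_scal c u : 0 <= c -> P u -> P (scal c u).
Proof. apply (ass_cone hX). Qed.

Lemma cone_antisym u v : P (minus u v) -> P (minus v u) -> u = v.
Proof.
  intros h1 h2. assert (h : minus u v = zero).
  { apply (ass_proper hX); trivial.
    now replace (opp (minus u v)) with (minus v u) by vec. }
  replace u with (plus (minus u v) v) by vec. rewrite h. vec.
Qed.

Lemma cone_trans u v w : P (minus v u) -> P (minus w v) -> P (minus w u).
Proof.
  intros h1 h2. replace (minus w u) with (plus (minus w v) (minus v u)) by vec.
  now apply cone_plus.
Qed.

Lemma cone_upward u v : P u -> P (minus v u) -> P v.
Proof.
  intros h1 h2. replace v with (plus (minus v u) u) by vec. now apply cone_plus.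
Qed.

Lemma cone_tends x u : (forall n, P (x n)) -> tends x u -> P u.
Proof. apply closed_tends. exact (ass_closed hX). Qed.

Lemma norm_add u v : P u -> P v -> norm (plus u v) = norm u + norm v.
Proof. apply (ass_norm_additive hX). Qed.

Lemma norm_sub u v : P u -> P (minus v u) -> norm (minus v u) = norm v - norm u.
Proof.
  intros h1 h2. pose proof (norm_add h2 h1) as h.
  replace (plus (minus v u) u) with v in h by vec. lra.
Qed.

Lemma norm_mono u v : P u -> P (minus v u) -> norm u <= norm v.
Proof.
  intros h1 h2. pose proof (norm_sub h1 h2). pose proof (norm_ge_0 (minus v u)). lra.
Qed.

(** Additivity of the norm turns the norm of an increment into an increment of norms, so the
    sequence is Cauchy as soon as the bounded increasing real sequence of norms converges. *)
Lemma increasing_tends x C :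
  P (x O) -> (forall n, P (minus (x (S n)) (x n))) -> (forall n, norm (x n) <= C) ->
  exists l, tends x l.
Proof.
  intros h0 hS hC.
  assert (hmono : forall n m, (n <= m)%nat -> P (minus (x m) (x n))).
  { intros n m h. induction h as [|m h IH].
    - rewrite minus_self. apply cone_zero.
    - exact (cone_trans IH (hS m)). }
  assert (hP : forall n, P (x n)).
  { intros n. apply (@cone_upward (x O)); trivial. apply hmono. lia. }
  assert (hinc : forall n m, (n <= m)%nat -> norm (x n) <= norm (x m)).
  { intros n m h. apply norm_mono; auto. }
  destruct (ex_finite_lim_seq_incr (fun n => norm (x n)) C) as [l hl];
    [intros n; apply hinc; lia | exact hC |].
  assert (hle : forall n, norm (x n) <= l).
  { intros n. apply (is_lim_seq_incr_compare (fun n => norm (x n)) l hl).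
    intros m. apply hinc. lia. }
  apply cauchy_tends_tail with (fun n => l - norm (x n)).
  - intros n m h. rewrite norm_sub by auto. specialize (hle m). lra.
  - replace (Finite 0) with (Finite (l - l)) by (f_equal; ring).
    exact (is_lim_seq_minus' _ _ _ _ (is_lim_seq_const l) hl).
Qed.

Lemma sum_pow_le (q : R) (n : nat) : 0 <= q < 1 ->
  sum_n (fun k => q ^ k) n <= / (1 - q).
Proof.
  intros hq. rewrite sum_n_Reals, tech3 by lra.
  apply Rle_trans with ((1 - 0) / (1 - q)); [|right; field; lra].
  apply Rmult_le_compat_r; [left; apply Rinv_0_lt_compat; lra|].
  pose proof (pow_le q (S n)). lra.
Qed.

(** * Uniform decomposition along the generating cone *)

Definition cone_cost (c : R) u : Prop :=
  exists v w, P v /\ P w /\ u = minus v w /\ norm v + norm w <= c.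

Lemma cone_cost_minus c c' u v :
  cone_cost c u -> cone_cost c' v -> cone_cost (c + c') (minus u v).
Proof.
  intros (u1 & u2 & h1 & h2 & -> & hc) (v1 & v2 & k1 & k2 & -> & hc').
  exists (plus u1 v2), (plus u2 v1). repeat split; try now apply cone_plus.
  - vec.
  - rewrite !norm_add by trivial. lra.
Qed.

Lemma cone_cost_scal r c u : 0 <= r -> cone_cost c u -> cone_cost (r * c) (scal r u).
Proof.
  intros hr (u1 & u2 & h1 & h2 & -> & hc).
  exists (scal r u1), (scal r u2). repeat split; try now apply cone_scal.
  - vec.
  - rewrite !norm_scal_nonneg by trivial. rewrite <- Rmult_plus_distr_l.
    now apply Rmult_le_compat_l.
Qed.

(* Baire category argument. *)
Lemma cone_cost_somewhere_dense :
  exists (c : R) (u0 : X) (r : R), 0 < r /\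
    forall u, norm (minus u u0) < r -> forall eps, 0 < eps ->
      exists d, cone_cost c d /\ norm (minus u d) < eps.
Proof.
  apply NNPP. intros hno.
  (* A state is a stage [n], a centre and a radius. The next ball lies in the current one, has at
     most half its radius, and its closure misses every vector of cost at most [n]. *)
  assert (hstep : forall s : nat * X * posreal, exists t : nat * X * posreal,
    fst (fst t) = S (fst (fst s)) /\
    norm (minus (snd (fst t)) (snd (fst s))) + snd t <= snd s /\
    snd t <= snd s / 2 /\
    forall d, cone_cost (INR (fst (fst s))) d -> snd t < norm (minus (snd (fst t)) d)).
  { intros [[n u0] [r hr]]; simpl.
    destruct (classic (exists u, norm (minus u u0) < r /\ exists eps, 0 < eps /\
      forall d, cone_cost (INR n) d -> eps <= norm (minus u d)))
      as [(u & hu & eps & he & hd)|hnot].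
    - set (rho := Rmin (eps / 2) (Rmin (r - norm (minus u u0)) (r / 2))).
      assert (hrho : 0 < rho).
      { unfold rho. repeat apply Rmin_glb_lt; lra. }
      assert (h1 : rho <= eps / 2) by apply Rmin_l.
      assert (h2 : rho <= Rmin (r - norm (minus u u0)) (r / 2)) by apply Rmin_r.
      pose proof (Rmin_l (r - norm (minus u u0)) (r / 2)).
      pose proof (Rmin_r (r - norm (minus u u0)) (r / 2)).
      exists (S n, u, mkposreal rho hrho). simpl.
      repeat split; try lra. intros d hcd. specialize (hd d hcd). lra.
    - exfalso. apply hno. exists (INR n), u0, r. split; trivial.
      intros u hu eps he. apply NNPP. intros hd. apply hnot. exists u. split; trivial.
      exists eps. split; trivial. intros d hcd.
      apply Rnot_lt_le. intros hlt. apply hd. now exists d. }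
  destruct (functional_choice _ hstep) as [f hf].
  set (s := fun n => Nat.iter n f (O, zero, mkposreal 1 Rlt_0_1)).
  assert (hs : forall n, s (S n) = f (s n)) by reflexivity.
  assert (hidx : forall n, fst (fst (s n)) = n).
  { intros n. induction n as [|n IH]; trivial.
    rewrite hs. destruct (hf (s n)) as [-> _]. now rewrite IH. }
  set (x := fun n => snd (fst (s n))). set (r := fun n => pos (snd (s n))).
  assert (hr : forall n, r n <= 1 * (/ 2) ^ n).
  { intros n. induction n as [|n IH]; [unfold r; simpl; lra|].
    destruct (hf (s n)) as (_ & _ & h & _). unfold r in *. rewrite hs. simpl. lra. }
  assert (hnest : forall n m, (n <= m)%nat -> norm (minus (x m) (x n)) <= r n - r m).
  { intros n m h. induction h as [|m h IH].
    - rewrite minus_self, norm_of_zero. lra.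
    - destruct (hf (s m)) as (_ & h' & _). fold (x m) (r m) in h'.
      rewrite <- hs in h'. fold (x (S m)) (r (S m)) in h'.
      pose proof (norm_minus_trans (x m) (x (S m)) (x n)). lra. }
  assert (hrpos : forall n, 0 < r n) by (intros n; apply cond_pos).
  destruct (@cauchy_tends_tail X x (fun n => 1 * (/ 2) ^ n)) as [z hz].
  { intros n m h. specialize (hnest n m h). specialize (hr n). specialize (hrpos m). lra. }
  { apply tends_geom. lra. }
  assert (hzn : forall n, norm (minus z (x n)) <= r n).
  { intros n. apply le_epsilon. intros eps he.
    destruct (proj1 (tends_eps x z) hz eps he) as [N hN].
    specialize (hN (N + n)%nat (Nat.le_add_r _ _)).
    specialize (hnest n (N + n)%nat (Nat.le_add_l _ _)).
    pose proof (norm_minus_trans (x (N + n)%nat) z (x n)).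
    rewrite (norm_minus_sym z (x (N + n)%nat)) in H.
    specialize (hrpos (N + n)%nat). lra. }
  destruct (ass_generating hX z) as (v & w & hv & hw & hz').
  (* The cost of the limit point lies below [k + 1], so stage [S k] should have excluded it,
     although it belongs to all the balls. *)
  destruct (nfloor_ex (norm v + norm w)) as [k [_ hk]].
  { pose proof (norm_ge_0 v). pose proof (norm_ge_0 w). lra. }
  destruct (hf (s (S k))) as (_ & _ & _ & h).
  assert (hc : cone_cost (INR (fst (fst (s (S k))))) z).
  { exists v, w. rewrite hidx, S_INR. repeat split; trivial. lra. }
  specialize (h z hc). rewrite <- hs in h. fold (x (S (S k))) in h.
  specialize (hzn (S (S k))). rewrite norm_minus_sym in hzn. unfold r in hzn. lra.
Qed.

(** With [s = r / (2 |u|)], both [u0 + s u] and [u0] lie in the ball of density and are approximated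
    within [r / 8] at cost [c]. Subtracting and dividing by [s] approximates [u] at cost
    [2 c / s = (4 c / r) |u|] with error at most [(r / 4) / s = |u| / 2]. *)
Lemma cone_cost_half :
  exists c, 0 <= c /\ forall u, exists v w,
    P v /\ P w /\ norm v + norm w <= c * norm u /\
    norm (minus u (minus v w)) <= norm u / 2.
Proof.
  destruct cone_cost_somewhere_dense as (c & u0 & r & hr & hd).
  assert (h00 : norm (minus u0 u0) < r) by (rewrite minus_self, norm_of_zero; easy).
  assert (hc : 0 <= c).
  { destruct (hd u0 h00 1 Rlt_0_1) as (d & (v & w & _ & _ & _ & h) & _).
    pose proof (norm_ge_0 v). pose proof (norm_ge_0 w). lra. }
  exists (4 * c / r). split.
  { apply Rmult_le_pos; [lra|left; now apply Rinv_0_lt_compat]. }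
  intros u. destruct (Req_dec (norm u) 0) as [hu|hu].
  { exists zero, zero. rewrite hu, norm_of_zero. repeat split; try apply cone_zero; [lra|].
    replace (minus u (minus zero zero)) with u by vec. lra. }
  assert (hu' : 0 < norm u) by (pose proof (norm_ge_0 u); lra).
  set (s := r / (2 * norm u)).
  assert (hs : 0 < s) by (apply Rdiv_lt_0_compat; lra).
  assert (hsu : s * norm u = r / 2) by (unfold s; field; lra).
  destruct (hd (plus u0 (scal s u))) with (r / 8) as (d1 & hc1 & h1); [|lra|].
  { replace (minus (plus u0 (scal s u)) u0) with (scal s u) by vec.
    rewrite norm_scal_nonneg by lra. lra. }
  destruct (hd u0 h00 (r / 8)) as (d0 & hc0 & h0); [lra|].
  destruct (cone_cost_scal (r := / s) (c := c + c) (u := minus d1 d0))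
    as (v & w & hv & hw & hvw & hcost).
  { left; now apply Rinv_0_lt_compat. }
  { now apply cone_cost_minus. }
  exists v, w. repeat split; trivial.
  - replace (4 * c / r * norm u) with (/ s * (c + c)); trivial.
    unfold s. field. split; lra.
  - rewrite <- hvw.
    replace (minus u (scal (/ s) (minus d1 d0)))
      with (scal (/ s) (minus (minus (plus u0 (scal s u)) d1) (minus u0 d0)))
      by (vec; field; lra).
    rewrite norm_scal_nonneg by (left; now apply Rinv_0_lt_compat).
    pose proof (norm_minus_le (minus (plus u0 (scal s u)) d1) (minus u0 d0)).
    apply Rle_trans with (/ s * (s * norm u / 2)).
    + apply Rmult_le_compat_l; [left; now apply Rinv_0_lt_compat|lra].
    + right. field. lra.
Qed.

(** The approximate decomposition is applied again to each remainder. Remainders halve, so the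
    positive and negative parts are summable in the cone, and their sums decompose [u] exactly, as
    in the proof of the open mapping theorem. *)
Lemma cone_decomposition :
  exists M, 1 <= M /\ forall u, cone_cost (M * norm u) u.
Proof.
  destruct cone_cost_half as (c & hc & hd).
  assert (hd' : forall u, exists vw : X * X,
    P (fst vw) /\ P (snd vw) /\ norm (fst vw) + norm (snd vw) <= c * norm u /\
    norm (minus u (minus (fst vw) (snd vw))) <= norm u / 2).
  { intros u. destruct (hd u) as (v & w & h). now exists (v, w). }
  destruct (functional_choice _ hd') as [f hf].
  (* Each of the two sums has norm at most [2 c |u|]; the added [1] secures [1 <= M]. *)
  exists (4 * c + 1). split; [lra|]. intros u.
  set (x := fun n => Nat.iter n (fun v : X => minus v (minus (fst (f v)) (snd (f v)))) u).
  assert (hx : forall n, norm (x n) <= norm u * (/ 2) ^ n).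
  { intros n. induction n as [|n IH]; [unfold x; simpl; lra|].
    destruct (hf (x n)) as (_ & _ & _ & h).
    change (x (S n)) with (minus (x n) (minus (fst (f (x n))) (snd (f (x n))))).
    simpl. lra. }
  assert (hsum : forall g : X -> X,
    (forall v, P (g v) /\ norm (g v) <= c * norm v) ->
    exists l, tends (fun n => sum_n (fun k => g (x k)) n) l /\ P l /\
      norm l <= 2 * c * norm u).
  { intros g hg.
    assert (hP : forall n, P (sum_n (fun k => g (x k)) n)).
    { intros n. induction n as [|n IH].
      - rewrite sum_O. apply hg.
      - rewrite sum_Sn. apply cone_plus; trivial. apply hg. }
    assert (hb : forall n, norm (sum_n (fun k => g (x k)) n) <= 2 * c * norm u).
    { intros n. apply Rle_trans with (c * norm u * sum_n (fun k => (/ 2) ^ k) n).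
      - induction n as [|n IH].
        + rewrite !sum_O. destruct (hg (x O)) as [_ h]. specialize (hx O).
          apply (Rmult_le_compat_l c) in hx; trivial. simpl in *. lra.
        + rewrite !sum_Sn, norm_add by (trivial; apply hg).
          destruct (hg (x (S n))) as [_ h]. specialize (hx (S n)).
          apply (Rmult_le_compat_l c) in hx; trivial.
          change (plus ?a ?b) with (a + b). rewrite Rmult_plus_distr_l. lra.
      - pose proof (sum_pow_le (q := / 2) n ltac:(lra)) as h.
        apply (Rmult_le_compat_l (c * norm u)) in h.
        + lra.
        + apply Rmult_le_pos; trivial. exact (norm_ge_0 u). }
    destruct (increasing_tends (x := fun n => sum_n (fun k => g (x k)) n)
      (C := 2 * c * norm u)) as [l hl]; trivial.
    - intros n. rewrite sum_Sn.
      replace (minus (plus (sum_n (fun k => g (x k)) n) (g (x (S n))))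
        (sum_n (fun k => g (x k)) n)) with (g (x (S n))) by vec. apply hg.
    - exists l. split; trivial. split.
      + exact (cone_tends hP hl).
      + exact (tends_norm_le hl hb). }
  destruct (hsum (fun v => fst (f v))) as (v & hv & hPv & hnv).
  { intros v. destruct (hf v) as (h1 & h2 & h3 & _). split; trivial.
    pose proof (norm_ge_0 (snd (f v))). lra. }
  destruct (hsum (fun v => snd (f v))) as (w & hw & hPw & hnw).
  { intros w. destruct (hf w) as (h1 & h2 & h3 & _). split; trivial.
    pose proof (norm_ge_0 (fst (f w))). lra. }
  exists v, w. repeat split; trivial.
  - refine (tends_unique (x := fun _ => u) (tends_const u) _).
    (* The remainder [x (S n)] plus the corrections of indices [0] to [n] is always [u], and the
       remainder vanishes in the limit. *)
    apply (tends_ext (x := fun n => plus (x (S n))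
      (minus (sum_n (fun k => fst (f (x k))) n) (sum_n (fun k => snd (f (x k))) n)))).
    + intros n. induction n as [|n IH].
      * rewrite !sum_O. unfold x; simpl. vec.
      * refine (eq_trans _ IH). rewrite !sum_Sn.
        change (x (S (S n))) with
          (minus (x (S n)) (minus (fst (f (x (S n)))) (snd (f (x (S n)))))).
        vec.
    + replace (minus v w) with (plus zero (minus v w)) by vec.
      apply tends_plus; [|now apply tends_minus].
      apply tends_S. apply tends_squeeze with (fun n => norm u * (/ 2) ^ n).
      * intros n. replace (minus (x n) zero) with (x n) by vec. apply hx.
      * apply tends_geom. lra.
  - pose proof (norm_ge_0 u). lra.
Qed.

End Cone.

(** * Positive operators bounded on the cone *)

Fixpoint geom (c : R) (n : nat) : R :=
  match n with O => 0 | S m => geom c m + c ^ m end.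

Lemma geom_le (c : R) (n : nat) : 0 <= c < 1 -> geom c n <= / (1 - c).
Proof.
  intros hc. assert (h : geom c n = (1 - c ^ n) * / (1 - c)).
  { induction n as [|n IH]; simpl; [|rewrite IH]; field; lra. }
  rewrite h. assert (0 < / (1 - c)) by (apply Rinv_0_lt_compat; lra).
  pose proof (pow_le c n). nra.
Qed.

Section Operators.
Import VectorOperations.
Context (X : RBanach) (P : X -> Prop) (hX : is_abstract_state_space P).
Context (M : R) (hM1 : 1 <= M) (hM : forall u : X, cone_cost P (M * norm u) u).
Implicit Types (u v w : X) (x : nat -> X) (F G : X -> X) (c : R).

(** The bound is imposed on the cone only: there the constants multiply exactly under composition,
    and [op_bound] then charges a single factor [M] for an arbitrarily long composite. *)
Record positive_op (c : R) (F : X -> X) : Prop := {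
  op_plus : forall u v, F (plus u v) = plus (F u) (F v);
  op_scal : forall (r : R) u, F (scal r u) = scal r (F u);
  op_pos : forall u, P u -> P (F u);
  op_norm : forall u, P u -> norm (F u) <= c * norm u
}.

Lemma op_minus c F u v : positive_op c F -> F (minus u v) = minus (F u) (F v).
Proof.
  intros hF. replace (minus u v) with (plus u (scal (-1) v)) by vec.
  rewrite (op_plus hF), (op_scal hF). vec.
Qed.

Lemma op_zero c F : positive_op c F -> F zero = zero.
Proof.
  intros hF. replace (zero : X) with (scal 0 (zero : X)) at 1 by vec.
  rewrite (op_scal hF). vec.
Qed.

Lemma op_mono c F u v : positive_op c F -> P (minus v u) -> P (minus (F v) (F u)).
Proof. intros hF h. rewrite <- (op_minus _ _ hF). now apply (op_pos hF). Qed.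

Lemma op_bound c F u : 0 <= c -> positive_op c F -> norm (F u) <= c * M * norm u.
Proof.
  intros hc hF. destruct (hM u) as (v & w & hv & hw & hu & hcost).
  rewrite hu at 1. rewrite (op_minus _ _ hF).
  pose proof (norm_minus_le (F v) (F w)).
  pose proof (op_norm hF hv). pose proof (op_norm hF hw).
  apply (Rmult_le_compat_l c) in hcost; trivial. lra.
Qed.

Lemma op_dist c F u v : 0 <= c -> positive_op c F ->
  norm (minus (F u) (F v)) <= c * M * norm (minus u v).
Proof. intros hc hF. rewrite <- (op_minus _ _ hF). now apply op_bound. Qed.

Lemma op_tends c F x u : 0 <= c -> positive_op c F ->
  tends x u -> tends (fun n => F (x n)) (F u).
Proof.
  intros hc hF. apply tends_bounded_map with (c * M). intros v w. now apply op_dist.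
Qed.

Lemma op_ext_cone c c' F G : positive_op c F -> positive_op c' G ->
  (forall u, P u -> F u = G u) -> forall u, F u = G u.
Proof.
  intros hF hG h u. destruct (ass_generating hX u) as (v & w & hv & hw & ->).
  change (F (minus v w) = G (minus v w)).
  rewrite (op_minus _ _ hF), (op_minus _ _ hG), !h; trivial.
Qed.

Lemma op_id : positive_op 1 (fun u => u).
Proof. split; trivial. intros u _. lra. Qed.

Lemma op_weaken c c' F : c <= c' -> positive_op c F -> positive_op c' F.
Proof.
  intros hc hF. split; try apply hF. intros u hu.
  pose proof (op_norm hF hu). pose proof (norm_ge_0 u). nra.
Qed.

Lemma op_comp c c' F G : 0 <= c -> positive_op c F -> positive_op c' G ->
  positive_op (c * c') (fun u => F (G u)).
Proof.
  intros hc hF hG. split; intros.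
  - now rewrite (op_plus hG), (op_plus hF).
  - now rewrite (op_scal hG), (op_scal hF).
  - now apply (op_pos hF), (op_pos hG).
  - pose proof (op_norm hF (op_pos hG H)). pose proof (op_norm hG H). nra.
Qed.

Lemma op_add c c' F G : positive_op c F -> positive_op c' G ->
  positive_op (c + c') (fun u => plus (F u) (G u)).
Proof.
  intros hF hG. split; intros.
  - rewrite (op_plus hG), (op_plus hF). vec.
  - rewrite (op_scal hG), (op_scal hF). vec.
  - apply (cone_plus hX); [now apply (op_pos hF)|now apply (op_pos hG)].
  - pose proof (op_norm hF H). pose proof (op_norm hG H).
    pose proof (norm_plus_le (F u) (G u)). lra.
Qed.

Lemma op_scale r c F : 0 <= r -> positive_op c F ->
  positive_op (r * c) (fun u => scal r (F u)).
Proof.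
  intros hr hF. split; intros.
  - rewrite (op_plus hF). vec.
  - rewrite (op_scal hF). vec.
  - apply (cone_scal hX); trivial. now apply (op_pos hF).
  - rewrite norm_scal_nonneg by trivial. pose proof (op_norm hF H). nra.
Qed.

Lemma op_iter c F n : 0 <= c -> positive_op c F ->
  positive_op (c ^ n) (fun u => Nat.iter n F u).
Proof.
  intros hc hF. induction n as [|n IH]; [exact op_id|].
  exact (op_comp hc hF IH).
Qed.

Lemma op_iter_mono c c' F G n u : positive_op c F -> positive_op c' G ->
  (forall v, P v -> P (minus (G v) (F v))) -> P u ->
  P (minus (Nat.iter n G u) (Nat.iter n F u)).
Proof.
  intros hF hG h hu.
  assert (hp : forall m, P (Nat.iter m F u)).
  { intros m. induction m as [|m IH]; trivial. now apply (op_pos hF). }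
  induction n as [|n IH]; simpl.
  - rewrite minus_self. apply (cone_zero hX).
  - apply (cone_trans hX (v := G (Nat.iter n F u))).
    + now apply h.
    + now apply (op_mono hG).
Qed.

Lemma op_iter_one F n : positive_op 1 F -> positive_op 1 (fun u => Nat.iter n F u).
Proof. intros hF. rewrite <- (pow1 n). apply op_iter; [lra|easy]. Qed.

Lemma op_iter_bound F n u : positive_op 1 F -> norm (Nat.iter n F u) <= M * norm u.
Proof.
  intros hF. replace M with (1 * M) by ring.
  apply (op_bound u Rle_0_1 (op_iter_one n hF)).
Qed.

Lemma op_limit c (F : nat -> X -> X) (G : X -> X) :
  (forall n, positive_op c (F n)) -> (forall u, tends (fun n => F n u) (G u)) ->
  positive_op c G.
Proof.
  intros hF hG. split; intros.
  - apply (tends_unique (hG (plus u v))).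
    apply (tends_ext (x := fun n => plus (F n u) (F n v))).
    + intros n. symmetry. apply (op_plus (hF n)).
    + now apply tends_plus.
  - apply (tends_unique (hG (scal r u))).
    apply (tends_ext (x := fun n => scal r (F n u))).
    + intros n. symmetry. apply (op_scal (hF n)).
    + now apply tends_scal.
  - apply (cone_tends hX (x := fun n => F n u)); trivial. intros n. now apply (op_pos (hF n)).
  - apply (tends_norm_le (hG u)). intros n. now apply (op_norm (hF n)).
Qed.

Lemma op_limit_exists c (F : nat -> X -> X) :
  (forall n, positive_op c (F n)) ->
  (forall u, P u -> exists l, tends (fun n => F n u) l) ->
  forall u, tends (fun n => F n u) (vlim (fun n => F n u)).
Proof.
  intros hF h u. apply vlim_correct.
  destruct (ass_generating hX u) as (v & w & hv & hw & ->).
  destruct (h v hv) as [l hl]. destruct (h w hw) as [l' hl'].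
  exists (minus l l').
  apply (tends_ext (x := fun n => minus (F n v) (F n w))).
  - intros n. symmetry. exact (op_minus v w (hF n)).
  - now apply tends_minus.
Qed.

Fixpoint psum (F : X -> X) (n : nat) (u : X) : X :=
  match n with O => zero | S m => plus (psum F m u) (Nat.iter m F u) end.

Lemma op_psum c F n : 0 <= c -> positive_op c F -> positive_op (geom c n) (psum F n).
Proof.
  intros hc hF. induction n as [|n IH]; simpl.
  - split; intros; try vec.
    + apply (cone_zero hX).
    + rewrite norm_of_zero. lra.
  - exact (op_add IH (op_iter n hc hF)).
Qed.

Lemma psum_mono c c' F G n u : positive_op c F -> positive_op c' G ->
  (forall v, P v -> P (minus (G v) (F v))) -> P u ->
  P (minus (psum G n u) (psum F n u)).
Proof.
  intros hF hG h hu. induction n as [|n IH]; simpl.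
  - rewrite minus_self. apply (cone_zero hX).
  - replace (minus (plus (psum G n u) (Nat.iter n G u)) (plus (psum F n u) (Nat.iter n F u)))
      with (plus (minus (psum G n u) (psum F n u))
        (minus (Nat.iter n G u) (Nat.iter n F u))) by vec.
    apply (cone_plus hX); trivial. now apply (op_iter_mono n hF hG).
Qed.

(** After division by [n], an average over an orbit is as close to [v] as the orbit is. This plays
    the role of the continuity of integral means of a semigroup. *)
Lemma psum_average F n u v eps :
  (forall j, (j < n)%nat -> norm (minus (Nat.iter j F u) v) <= eps) ->
  norm (minus (psum F n u) (scal (INR n) v)) <= INR n * eps.
Proof.
  induction n as [|n IH]; intros h.
  - simpl. replace (minus zero (scal 0 v)) with (zero : X) by vec. rewrite norm_of_zero. lra.
  - rewrite S_INR. simpl psum.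
    replace (minus (plus (psum F n u) (Nat.iter n F u)) (scal (INR n + 1) v))
      with (plus (minus (psum F n u) (scal (INR n) v)) (minus (Nat.iter n F u) v)) by vec.
    eapply Rle_trans; [apply norm_plus_le|].
    pose proof (h n (Nat.lt_succ_diag_r n)).
    specialize (IH (fun j hj => h j (Nat.lt_lt_succ_r _ _ hj))). lra.
Qed.

Lemma psum_shift c F n u : positive_op c F ->
  psum F (S n) u = plus u (psum F n (F u)).
Proof.
  intros hF. induction n as [|n IH]; [simpl; vec|].
  change (psum F (S (S n)) u) with (plus (psum F (S n) u) (Nat.iter (S n) F u)).
  rewrite IH, Nat.iter_succ_r. simpl. vec.
Qed.

Lemma psum_telescope c F n u : positive_op c F ->
  minus (psum F n u) (F (psum F n u)) = minus u (Nat.iter n F u).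
Proof.
  intros hF. induction n as [|n IH]; simpl.
  - rewrite (op_zero hF). vec.
  - rewrite (op_plus hF).
    replace (minus (plus (psum F n u) (Nat.iter n F u))
      (plus (F (psum F n u)) (F (Nat.iter n F u))))
      with (plus (minus (psum F n u) (F (psum F n u)))
        (minus (Nat.iter n F u) (F (Nat.iter n F u)))) by vec.
    rewrite IH. vec.
Qed.

Lemma psum_diff c F n u : positive_op c F ->
  psum F n (minus u (F u)) = minus u (Nat.iter n F u).
Proof.
  intros hF. rewrite <- (psum_telescope n u hF).
  induction n as [|n IH]; simpl.
  - rewrite (op_zero hF). vec.
  - rewrite IH, (op_plus hF).
    assert (h : Nat.iter n F (minus u (F u))
      = minus (Nat.iter n F u) (F (Nat.iter n F u))).
    { clear IH. induction n as [|n IH]; simpl; trivial. rewrite IH. apply (op_minus _ _ hF). }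
    rewrite h. vec.
Qed.

Lemma psum_tends c F u : 0 <= c < 1 -> positive_op c F ->
  tends (fun n => psum F n u) (vlim (fun n => psum F n u)).
Proof.
  intros hc hF. apply (@op_limit_exists (/ (1 - c)) (psum F)).
  - intros n. apply (op_weaken (geom_le n hc)). now apply op_psum.
  - clear u. intros u hu. apply (increasing_tends hX) with (/ (1 - c) * norm u).
    + apply (cone_zero hX).
    + intros n. simpl.
      replace (minus (plus (psum F n u) (Nat.iter n F u)) (psum F n u))
        with (Nat.iter n F u) by vec.
      apply (op_pos (op_iter n (proj1 hc) hF) hu).
    + intros n. apply op_norm; trivial. apply (op_weaken (geom_le n hc)).
      now apply op_psum.
Qed.

Lemma iter_tends_zero c F u : 0 <= c < 1 -> positive_op c F ->
  tends (fun n => Nat.iter n F u) zero.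
Proof.
  intros hc hF. apply tends_squeeze with (fun n => M * norm u * c ^ n).
  - intros n. replace (minus (Nat.iter n F u) zero) with (Nat.iter n F u) by vec.
    pose proof (op_bound u (pow_le c n (proj1 hc)) (op_iter n (proj1 hc) hF)). simpl in *. lra.
  - now apply tends_geom.
Qed.

(* [(1 - F)^{-1}] when [F] is a strict contraction on the cone. *)
Definition neumann F u : X := vlim (fun n => psum F n u).

Lemma op_neumann c F : 0 <= c < 1 -> positive_op c F ->
  positive_op (/ (1 - c)) (neumann F).
Proof.
  intros hc hF. apply op_limit with (psum F).
  - intros n. apply (op_weaken (geom_le n hc)). now apply op_psum.
  - intros u. exact (psum_tends hc hF).
Qed.

Lemma neumann_l c F u : 0 <= c < 1 -> positive_op c F ->
  neumann F (minus u (F u)) = u.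
Proof.
  intros hc hF. apply (tends_unique (psum_tends hc hF (u := minus u (F u)))).
  apply (tends_ext (x := fun n => minus u (Nat.iter n F u))).
  - intros n. symmetry. now apply (@psum_diff c).
  - exact (tends_minus_zero (iter_tends_zero u hc hF)).
Qed.

Lemma neumann_r c F u : 0 <= c < 1 -> positive_op c F ->
  minus (neumann F u) (F (neumann F u)) = u.
Proof.
  intros hc hF.
  apply (tends_unique (x := fun n => minus (psum F n u) (F (psum F n u)))).
  - apply tends_minus.
    + exact (psum_tends hc hF).
    + apply (op_tends (proj1 hc) hF). exact (psum_tends hc hF).
  - apply (tends_ext (x := fun n => minus u (Nat.iter n F u))).
    + intros n. symmetry. now apply (@psum_telescope c).
    + exact (tends_minus_zero (iter_tends_zero u hc hF)).
Qed.

End Operators.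

(** * Resolvents of substochastic semigroups *)

(** All bounds come from [exp y >= 1 + y] at [y = x] and [y = - x]: since [exp x * exp (- x) = 1],
    the second gives [exp x * (1 - x) <= 1]. *)
Lemma exp_approx (x : R) : Rabs x <= / 2 ->
  0 < exp x <= 2 /\ Rabs (exp x - 1) <= 2 * Rabs x /\ Rabs (exp x - 1 - x) <= 2 * x ^ 2.
Proof.
  intros hx.
  assert (h1 : 1 + x <= exp x).
  { destruct (Req_dec x 0) as [->|h]; [rewrite exp_0; lra|].
    left. now apply exp_ineq1. }
  assert (h2 : 1 - x <= exp (- x)).
  { destruct (Req_dec x 0) as [->|h]; [rewrite Ropp_0, exp_0; lra|].
    left. replace (1 - x) with (1 + - x) by ring. apply exp_ineq1. lra. }
  assert (hx' : - / 2 <= x <= / 2) by now apply Rabs_le_between.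
  assert (hp : exp x * exp (- x) = 1) by (rewrite <- exp_plus, Rplus_opp_r; apply exp_0).
  pose proof (exp_pos x).
  assert (h3 : exp x - 1 - x <= 2 * x ^ 2).
  { assert (exp x * (1 - x) <= 1) by nra. nra. }
  rewrite (Rabs_pos_eq (exp x - 1 - x)) by lra.
  repeat split; trivial; [nra|].
  unfold Rabs. destruct (Rcase_abs (exp x - 1)); destruct (Rcase_abs x); nra.
Qed.

Section Derivative.
Import VectorOperations.
Context (X : RBanach).
Implicit Types (u v w : X).

(** This is [is_gen] multiplied through by [s], a form convenient for product rules and for applying
    bounded operators. *)
Definition has_right_derivative (F : R -> X) (w v : X) : Prop :=
  forall eps, 0 < eps -> exists delta, 0 < delta /\ forall s, 0 < s < delta ->
    norm (minus (minus (F s) w) (scal s v)) <= eps * s.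

Lemma at_right_0 (Q : R -> Prop) :
  at_right 0 Q <-> exists delta, 0 < delta /\ forall s, 0 < s < delta -> Q s.
Proof.
  split.
  - intros [[d hd] h]. exists d. split; trivial. intros s hs. apply h; [|lra].
    change (Rabs (s - 0) < d). rewrite Rabs_pos_eq; lra.
  - intros (d & hd & h). exists (mkposreal d hd). intros s hs hs0. apply h.
    change (Rabs (s - 0) < d) in hs. rewrite Rabs_pos_eq in hs; lra.
Qed.

Lemma is_gen_right_derivative (T : R -> X -> X) u v :
  is_gen T u v <-> has_right_derivative (fun s => T s u) u v.
Proof.
  assert (hsc : forall s, 0 < s ->
    minus (scal (/ s) (minus (T s u) u)) v
    = scal (/ s) (minus (minus (T s u) u) (scal s v))).
  { intros s hs. vec; field; lra. }
  assert (hn : forall s, 0 < s ->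
    norm (minus (scal (/ s) (minus (T s u) u)) v)
    = / s * norm (minus (minus (T s u) u) (scal s v))).
  { intros s hs. rewrite hsc by easy. apply norm_scal_nonneg.
    left. now apply Rinv_0_lt_compat. }
  unfold is_gen. split; intros h.
  - intros eps he.
    apply (filterlim_norm_eps (filter_filter (F := at_right 0))) with (eps := eps) in h; trivial.
    apply at_right_0 in h. destruct h as (d & hd & h). exists d. split; trivial.
    intros s hs. specialize (h s hs).
    change (norm (minus (scal (/ s) (minus (T s u) u)) v) < eps) in h.
    rewrite hn in h by lra. apply (Rmult_lt_compat_l s) in h; [|lra].
    rewrite <- Rmult_assoc, Rinv_r, Rmult_1_l in h; lra.
  - apply (filterlim_norm_eps (filter_filter (F := at_right 0))). intros eps he.
    destruct (h (eps / 2)) as (d & hd & hd'); [lra|].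
    apply at_right_0. exists d. split; trivial. intros s hs. specialize (hd' s hs).
    change (norm (minus (scal (/ s) (minus (T s u) u)) v) < eps).
    rewrite hn by lra. apply (Rmult_le_compat_l (/ s)) in hd'.
    + replace (/ s * (eps / 2 * s)) with (eps / 2) in hd' by (field; lra). lra.
    + left. apply Rinv_0_lt_compat. lra.
Qed.

Lemma is_gen_unique (T : R -> X -> X) u v w : is_gen T u v -> is_gen T u w -> v = w.
Proof.
  intros h1 h2. exact (filterlim_locally_unique (F := at_right 0) _ v w h1 h2).
Qed.

Lemma gen_correct (T : R -> X -> X) u v : is_gen T u v -> gen T u = v.
Proof.
  intros h. apply iota_unique; trivial. intros w hw. exact (is_gen_unique hw h).
Qed.

Lemma gen_is_gen (T : R -> X -> X) u : gen_dom T u -> is_gen T u (gen T u).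
Proof. intros [v hv]. now rewrite (gen_correct hv). Qed.

(** This product rule passes between [T] and its exponentially damped version. The error splits into
    [exp (a s)] times the error of [F], plus [(exp (a s) - 1 - a s) w] and [s (exp (a s) - 1) v],
    both of second order in [s]. *)
Lemma right_derivative_exp (a : R) (F : R -> X) w v :
  has_right_derivative F w v ->
  has_right_derivative (fun s => scal (exp (a * s)) (F s)) w (plus v (scal a w)).
Proof.
  intros h eps he.
  destruct (h (eps / 4)) as (d & hd & hd'); [lra|].
  set (A := Rabs a + 1).
  assert (hA : Rabs a <= A /\ 1 <= A) by (unfold A; pose proof (Rabs_pos a); lra).
  set (N := norm w + norm v + 1).
  pose proof (norm_ge_0 w) as hw0. pose proof (norm_ge_0 v) as hv0.
  assert (hN : 1 <= N) by (unfold N; lra).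
  assert (hB : 0 < 8 * A * A * N) by (repeat apply Rmult_lt_0_compat; lra).
  (* The second entry keeps [|a s| <= 1/2], as [exp_approx] requires; the third makes the
     second-order terms at most [s * eps / 4], and the damped error of [F] contributes at most
     [s * eps / 2]. *)
  exists (Rmin d (Rmin (/ (2 * A)) (eps / (8 * A * A * N)))). split.
  { repeat apply Rmin_glb_lt; trivial.
    - apply Rinv_0_lt_compat. lra.
    - now apply Rdiv_lt_0_compat. }
  intros s [hs0 hs].
  assert (hsd : s < d) by (eapply Rlt_le_trans; [exact hs|apply Rmin_l]).
  assert (hs' : s < Rmin (/ (2 * A)) (eps / (8 * A * A * N)))
    by (eapply Rlt_le_trans; [exact hs|apply Rmin_r]).
  assert (hs1 : s < / (2 * A)) by (eapply Rlt_le_trans; [exact hs'|apply Rmin_l]).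
  assert (hs2 : s < eps / (8 * A * A * N)) by (eapply Rlt_le_trans; [exact hs'|apply Rmin_r]).
  assert (hs1' : A * s < / 2).
  { apply (Rmult_lt_compat_l A) in hs1; [|lra].
    replace (A * / (2 * A)) with (/ 2) in hs1 by (field; lra). easy. }
  assert (hs2' : 8 * A * A * N * s < eps).
  { apply (Rmult_lt_compat_l (8 * A * A * N)) in hs2; trivial.
    replace (8 * A * A * N * (eps / (8 * A * A * N))) with eps in hs2 by (field; lra).
    easy. }
  assert (has : Rabs (a * s) <= A * s).
  { rewrite Rabs_mult, (Rabs_pos_eq s) by lra. apply Rmult_le_compat_r; lra. }
  destruct (exp_approx (x := a * s)) as (h1 & h2 & h3); [lra|].
  replace (minus (minus (scal (exp (a * s)) (F s)) w) (scal s (plus v (scal a w))))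
    with (plus (scal (exp (a * s)) (minus (minus (F s) w) (scal s v)))
      (plus (scal (exp (a * s) - 1 - a * s) w) (scal (s * (exp (a * s) - 1)) v))) by vec.
  specialize (hd' s (conj hs0 hsd)).
  eapply Rle_trans; [apply norm_plus_le|].
  eapply Rle_trans; [apply Rplus_le_compat_l, norm_plus_le|].
  rewrite norm_scal_nonneg by lra.
  pose proof (norm_scal_le (exp (a * s) - 1 - a * s) w) as k1.
  pose proof (norm_scal_le (s * (exp (a * s) - 1)) v) as k2.
  rewrite Rabs_mult, (Rabs_pos_eq s) in k2 by lra.
  assert (k0 : exp (a * s) * norm (minus (minus (F s) w) (scal s v)) <= 2 * (eps / 4 * s)).
  { apply Rmult_le_compat; try lra. apply norm_ge_0. }
  assert (hsq : (a * s) ^ 2 <= (A * s) ^ 2).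
  { rewrite <- (Rabs_pos_eq ((a * s) ^ 2)) by apply pow2_ge_0.
    rewrite <- RPow_abs. apply pow_incr. split; [apply Rabs_pos|easy]. }
  assert (k1' : Rabs (exp (a * s) - 1 - a * s) * norm w <= 2 * (A * s) ^ 2 * norm w).
  { apply Rmult_le_compat_r; trivial. lra. }
  assert (k2' : s * Rabs (exp (a * s) - 1) * norm v <= s * (2 * (A * s)) * norm v).
  { apply Rmult_le_compat_r; trivial. apply Rmult_le_compat_l; lra. }
  assert (k3 : 2 * (A * s) ^ 2 * norm w + s * (2 * (A * s)) * norm v
    <= s * (2 * A * A * N * s)).
  { assert (0 <= A * s * s) by (repeat apply Rmult_le_pos; lra).
    assert (A * s * s <= A * A * s * s) by nra.
    assert (A * s * s * norm v <= A * A * s * s * norm v) by now apply Rmult_le_compat_r.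
    unfold N. assert (0 <= A * A * s * s) by lra. simpl. nra. }
  assert (k4 : s * (2 * A * A * N * s) <= s * (eps / 4)).
  { apply Rmult_le_compat_l; lra. }
  assert (0 < eps * s) by now apply Rmult_lt_0_compat.
  lra.
Qed.

End Derivative.

Lemma inv2_pow_pos (n : nat) : 0 < (/ 2) ^ n.
Proof. apply pow_lt. lra. Qed.

Lemma inv2_pow_le (n m : nat) : (n <= m)%nat -> (/ 2) ^ m <= (/ 2) ^ n.
Proof.
  intros h. induction h as [|m h IH]; [lra|]. simpl. pose proof (inv2_pow_pos m). lra.
Qed.

Lemma inv2_pow_le_1 (n : nat) : (/ 2) ^ n <= 1.
Proof. apply (@inv2_pow_le 0 n). lia. Qed.

Lemma inv2_pow_small (eps : R) : 0 < eps ->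
  exists N, forall n, (N <= n)%nat -> (/ 2) ^ n < eps.
Proof.
  intros he. destruct (pow_lt_1_zero (/ 2)) with (y := eps) as [N hN]; trivial.
  { rewrite Rabs_pos_eq; lra. }
  exists N. intros n hn. specialize (hN n hn). rewrite Rabs_pos_eq in hN; trivial.
  left. apply inv2_pow_pos.
Qed.

Section Resolvent.
Import VectorOperations.
Context (X : RBanach) (P : X -> Prop) (hX : is_abstract_state_space P).
Context (M : R) (hM1 : 1 <= M) (hM : forall u : X, cone_cost P (M * norm u) u).
Context (T : R -> X -> X) (hT : is_substochastic P T).
Implicit Types (u v w : X).

Lemma substochastic_op t : 0 <= t -> positive_op P 1 (T t).
Proof.
  intros ht. destruct (sg_bounded_linear (sub_C0 hT) ht) as [h1 h2 _].
  split.
  - exact h1.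
  - exact h2.
  - intros u. now apply (sub_positive hT).
  - intros u hu. rewrite Rmult_1_l. now apply (sub_contractive hT).
Qed.

Lemma substochastic_continuous u eps : 0 < eps ->
  exists delta, 0 < delta /\ forall s, 0 <= s < delta -> norm (minus (T s u) u) < eps.
Proof.
  intros he. pose proof (@sg_continuous X T (sub_C0 hT) u) as h.
  apply (filterlim_norm_eps (filter_filter (F := at_right 0))) with (eps := eps) in h; trivial.
  apply at_right_0 in h. destruct h as (d & hd & h). exists d. split; trivial.
  intros s [hs hsd]. destruct (Req_dec s 0) as [->|hs0].
  - rewrite (sg_zero (sub_C0 hT)), minus_self, norm_of_zero. easy.
  - apply h. lra.
Qed.

Context (lam : R) (hlam : 0 < lam).

(** Subtracting [lam] from the generator makes each operator at [s > 0] a strict contraction on the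
    cone, so that [neumann] applies to it. *)
Definition damped (s : R) (u : X) : X := scal (exp (- lam * s)) (T s u).

Lemma damped_op s : 0 <= s -> positive_op P (exp (- lam * s)) (damped s).
Proof.
  intros hs. rewrite <- (Rmult_1_r (exp (- lam * s))).
  apply (op_scale hX); [left; apply exp_pos|now apply substochastic_op].
Qed.

Lemma damped_factor s : 0 < s -> 0 <= exp (- lam * s) < 1.
Proof.
  intros hs. split; [left; apply exp_pos|].
  rewrite <- exp_0. apply exp_increasing. nra.
Qed.

Lemma damped_op_1 s : 0 <= s -> positive_op P 1 (damped s).
Proof.
  intros hs. apply op_weaken with (exp (- lam * s)); [|now apply damped_op].
  destruct (Req_dec s 0) as [->|h0].
  - rewrite Rmult_0_r, exp_0. lra.
  - pose proof (@damped_factor s). lra.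
Qed.

Lemma damped_0 u : damped 0 u = u.
Proof. unfold damped. rewrite Rmult_0_r, exp_0, (sg_zero (sub_C0 hT)). vec. Qed.

Lemma damped_add s t u : 0 <= s -> 0 <= t -> damped (s + t) u = damped s (damped t u).
Proof.
  intros hs ht. unfold damped.
  rewrite (op_scal (substochastic_op hs)), (sg_add (sub_C0 hT) hs ht).
  rewrite Rmult_plus_distr_l, exp_plus. vec.
Qed.

Lemma damped_iter k n u : 0 <= k -> Nat.iter n (damped k) u = damped (INR n * k) u.
Proof.
  intros hk. induction n as [|n IH].
  - simpl. now rewrite Rmult_0_l, damped_0.
  - simpl Nat.iter. rewrite IH, <- damped_add.
    + f_equal. rewrite S_INR. ring.
    + easy.
    + apply Rmult_le_pos; [apply pos_INR|easy].
Qed.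

Lemma damped_continuous u eps : 0 < eps ->
  exists delta, 0 < delta /\ forall s, 0 <= s < delta -> norm (minus (damped s u) u) <= eps.
Proof.
  intros he. destruct (@substochastic_continuous u (eps / 2)) as (d & hd & h); [lra|].
  pose proof (norm_ge_0 u) as hu.
  set (d' := eps / 2 / (lam * (norm u + 1))).
  assert (hl : 0 < lam * (norm u + 1)) by (apply Rmult_lt_0_compat; lra).
  exists (Rmin d d'). split.
  { apply Rmin_glb_lt; trivial. apply Rdiv_lt_0_compat; lra. }
  intros s [hs hsd]. pose proof (Rmin_l d d'). pose proof (Rmin_r d d').
  assert (hs' : lam * (norm u + 1) * s <= eps / 2).
  { assert (k : s <= d') by lra. apply (Rmult_le_compat_l (lam * (norm u + 1))) in k; [|lra].
    unfold d' in k.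
    replace (lam * (norm u + 1) * (eps / 2 / (lam * (norm u + 1)))) with (eps / 2) in k
      by (field; lra). easy. }
  unfold damped.
  replace (minus (scal (exp (- lam * s)) (T s u)) u) with
    (plus (scal (exp (- lam * s)) (minus (T s u) u)) (scal (-1) (scal (1 - exp (- lam * s)) u)))
    by vec.
  assert (he1 : 0 <= exp (- lam * s) <= 1).
  { split; [left; apply exp_pos|]. rewrite <- exp_0.
    destruct (Req_dec s 0) as [->|h0]; [rewrite Rmult_0_r; lra|].
    left. apply exp_increasing. nra. }
  assert (he2 : 1 - exp (- lam * s) <= lam * s).
  { pose proof (exp_ineq1_le (- lam * s)). lra. }
  eapply Rle_trans; [apply norm_plus_le|].
  specialize (h s ltac:(lra)).
  pose proof (norm_scal_le (-1) (scal (1 - exp (- lam * s)) u)) as k.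
  replace (Rabs (-1)) with 1 in k by (rewrite Rabs_left; lra).
  rewrite norm_scal_nonneg by lra. rewrite (@norm_scal_nonneg X (1 - exp (- lam * s))) in k by lra.
  pose proof (norm_ge_0 (minus (T s u) u)). nra.
Qed.

(* [k sum_j exp(-lam j k) T(j k)], a Riemann sum of mesh [k] for the Laplace
   integral of [T]. *)
Definition laplace_sum (k : R) (u : X) : X := scal k (neumann (damped k) u).

(** The geometric series gives [k / (1 - exp (- lam k))], and [exp (lam k) >= 1 + lam k] bounds it.
    The constant is kept dependent on [k] because it must tend to the sharp [/ lam]; its value [C]
    at [k = 1] serves as the uniform bound. *)
Lemma op_laplace_sum k : 0 < k -> positive_op P ((1 + lam * k) / lam) (laplace_sum k).
Proof.
  intros hk. destruct (damped_factor hk) as [h0 h1].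
  apply op_weaken with (k * / (1 - exp (- lam * k))).
  - assert (h : (1 + lam * k) * exp (- lam * k) <= 1).
    { pose proof (exp_ineq1_le (lam * k)) as h.
      apply (Rmult_le_compat_r (exp (- lam * k))) in h; trivial.
      rewrite <- exp_plus in h.
      replace (lam * k + - lam * k) with 0 in h by ring. now rewrite exp_0 in h. }
    apply Rmult_le_reg_r with (lam * (1 - exp (- lam * k)));
      [apply Rmult_lt_0_compat; lra|].
    replace (k * / (1 - exp (- lam * k)) * (lam * (1 - exp (- lam * k)))) with (lam * k)
      by (field; lra).
    replace ((1 + lam * k) / lam * (lam * (1 - exp (- lam * k))))
      with ((1 + lam * k) - (1 + lam * k) * exp (- lam * k)) by (field; lra).
    lra.
  - apply (op_scale hX); [lra|].
    apply (op_neumann hX (c := exp (- lam * k))); [lra|]. apply damped_op. lra.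
Qed.

Let C := (1 + lam) / lam.

Lemma laplace_const_nonneg : 0 <= C.
Proof. unfold C. apply Rmult_le_pos; [lra|left; now apply Rinv_0_lt_compat]. Qed.

Lemma op_laplace_sum_C k : 0 < k <= 1 -> positive_op P C (laplace_sum k).
Proof.
  intros hk. apply op_weaken with ((1 + lam * k) / lam); [|apply op_laplace_sum; lra].
  unfold C. apply Rmult_le_compat_r; [left; now apply Rinv_0_lt_compat|nra].
Qed.

Lemma neumann_damped k u : 0 < k ->
  minus (neumann (damped k) u) (damped k (neumann (damped k) u)) = u.
Proof.
  intros hk. apply (neumann_r hX hM (c := exp (- lam * k))).
  - now apply damped_factor.
  - apply damped_op. lra.
Qed.

(** At fixed mesh the Riemann sum is already an exact resolvent, namely that of the difference
    quotient of the damped semigroup. Comparisons between meshes, and with the true generator, rest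
    on this. *)
Lemma laplace_sum_eq k w : 0 < k -> laplace_sum k (scal (/ k) (minus w (damped k w))) = w.
Proof.
  intros hk. unfold laplace_sum.
  assert (ho : positive_op P (exp (- lam * k)) (damped k)) by (apply damped_op; lra).
  rewrite (op_scal (op_neumann hX (damped_factor hk) ho)).
  rewrite (neumann_l hX hM w (damped_factor hk) ho). vec. field. lra.
Qed.

(* Since [1 - q^p = (1 - q) (1 + q + ... + q^(p-1))], refining the mesh replaces
   [u] by the average of the [q^j u]. *)
Lemma laplace_sum_refine k p u eps : 0 < k -> (0 < p)%nat -> INR p * k <= 1 ->
  (forall s, 0 <= s <= INR p * k -> norm (minus (damped s u) u) <= eps) ->
  norm (minus (laplace_sum k u) (laplace_sum (INR p * k) u)) <= C * M * eps.
Proof.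
  intros hk hp hpk hs. set (h := INR p * k) in *.
  assert (hp' : 0 < INR p) by (now apply lt_0_INR).
  assert (hh : 0 < h) by (unfold h; now apply Rmult_lt_0_compat).
  assert (hE : positive_op P C (laplace_sum h)) by (apply op_laplace_sum_C; lra).
  set (x := laplace_sum k u).
  assert (hx : minus x (damped h x) = scal k (psum (damped k) p u)).
  { assert (ho : positive_op P (exp (- lam * k)) (damped k)) by (apply damped_op; lra).
    unfold h, x. rewrite <- damped_iter by lra.
    rewrite <- (psum_diff p _ ho). unfold laplace_sum.
    assert (hq : minus (scal k (neumann (damped k) u))
      (damped k (scal k (neumann (damped k) u))) = scal k u).
    { rewrite (op_scal ho). rewrite <- (neumann_damped u hk) at 3. vec. }
    rewrite hq. apply (op_scal (op_psum hX p (Rlt_le _ _ (exp_pos _)) ho)). }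
  rewrite <- (laplace_sum_eq x hh), hx.
  eapply Rle_trans; [apply (op_dist hM _ _ laplace_const_nonneg hE)|].
  apply Rmult_le_compat_l; [apply Rmult_le_pos; [apply laplace_const_nonneg|lra]|].
  replace (minus (scal (/ h) (scal k (psum (damped k) p u))) u)
    with (scal (/ INR p) (minus (psum (damped k) p u) (scal (INR p) u)))
    by (vec; unfold h; field; lra).
  rewrite norm_scal_nonneg by (left; now apply Rinv_0_lt_compat).
  apply Rmult_le_reg_l with (INR p); trivial.
  rewrite <- Rmult_assoc, Rinv_r, Rmult_1_l by lra.
  apply psum_average. intros j hj. rewrite damped_iter by lra. apply hs.
  apply lt_INR in hj. pose proof (pos_INR j). unfold h. nra.
Qed.

Definition res (u : X) : X := vlim (fun n => laplace_sum ((/ 2) ^ n) u).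

(** Any two fine dyadic meshes refine the mesh [2^-N] by integer factors [2^(n - N)], so each is
    compared with that one through [laplace_sum_refine]. *)
Lemma res_tends u : tends (fun n => laplace_sum ((/ 2) ^ n) u) (res u).
Proof.
  apply vlim_correct. apply cauchy_tends. intros eps he.
  pose proof laplace_const_nonneg as hC.
  assert (hCM : 0 <= C * M) by (apply Rmult_le_pos; lra).
  set (e := eps / (4 * (C * M + 1))).
  assert (he' : 0 < e) by (apply Rdiv_lt_0_compat; lra).
  destruct (damped_continuous u he') as (d & hd & hcont).
  destruct (inv2_pow_small hd) as [N hN]. exists N.
  assert (key : forall n, (N <= n)%nat ->
    norm (minus (laplace_sum ((/ 2) ^ n) u) (laplace_sum ((/ 2) ^ N) u)) <= C * M * e).
  { intros n hn.
    assert (hp : (/ 2) ^ N = INR (2 ^ (n - N)) * (/ 2) ^ n).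
    { replace n with (n - N + N)%nat at 2 by lia. rewrite pow_add, pow_INR.
      simpl (INR 2). rewrite <- Rmult_assoc, <- Rpow_mult_distr.
      replace ((1 + 1) * / 2) with 1 by field. rewrite pow1. ring. }
    rewrite hp. apply laplace_sum_refine.
    - apply inv2_pow_pos.
    - apply Nat.neq_0_lt_0. apply Nat.pow_nonzero. lia.
    - rewrite <- hp. apply inv2_pow_le_1.
    - rewrite <- hp. intros s hs. apply hcont. specialize (hN N (le_n _)). lra. }
  assert (hsum : C * M * e + C * M * e < eps).
  { unfold e. apply Rmult_lt_reg_r with (4 * (C * M + 1)); [lra|].
    replace ((C * M * (eps / (4 * (C * M + 1))) + C * M * (eps / (4 * (C * M + 1))))
      * (4 * (C * M + 1))) with (2 * (C * M) * eps) by (field; lra). nra. }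
  intros n m hn hm.
  pose proof (norm_minus_trans (laplace_sum ((/ 2) ^ N) u) (laplace_sum ((/ 2) ^ n) u) (laplace_sum ((/ 2) ^ m) u)).
  rewrite (norm_minus_sym (laplace_sum ((/ 2) ^ N) u)) in H.
  pose proof (key n hn). pose proof (key m hm). lra.
Qed.

Lemma op_res : positive_op P (/ lam) res.
Proof.
  assert (h : positive_op P C res).
  { apply op_limit with (fun n => laplace_sum ((/ 2) ^ n)); trivial.
    - intros n. apply op_laplace_sum_C. split; [apply inv2_pow_pos|apply inv2_pow_le_1].
    - exact res_tends. }
  (* [h] carries only the constant [C]; the sharp [/ lam] is the limit of the constants
     [(1 + lam * k) / lam] along [k = 2^-n]. *)
  split; try apply h. intros u hu.
  assert (h1 : is_lim_seq (fun n => norm (laplace_sum ((/ 2) ^ n) u)) (norm (res u))).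
  { exact (filterlim_comp _ _ _ _ _ _ _ _ (@res_tends u) (filterlim_norm (res u))). }
  assert (h2 : is_lim_seq (fun n => / lam * norm u + norm u * (/ 2) ^ n) (/ lam * norm u + 0)).
  { apply is_lim_seq_plus'; [apply is_lim_seq_const|apply tends_geom; lra]. }
  rewrite Rplus_0_r in h2.
  refine (is_lim_seq_le _ _ _ _ _ h1 h2). intros n.
  pose proof (op_norm (op_laplace_sum (inv2_pow_pos n)) hu) as h3.
  replace (/ lam * norm u + norm u * (/ 2) ^ n) with ((1 + lam * (/ 2) ^ n) / lam * norm u)
    by (field; lra). easy.
Qed.

(** Discrete form of [w - q(s) w = int_0^s q(r) u dr], where [q] is the damped semigroup and
    [w = res u]. On the mesh [h] it is an exact telescoping sum up to the last mesh point [t] before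
    [s]; the leftover [r = s - t < h] is absorbed by continuity of [q] at [w] and by the smallness
    of [r u]. *)
Lemma damped_res_estimate u eps s :
  0 < s -> (forall r, 0 <= r <= s -> norm (minus (damped r u) u) <= eps) ->
  norm (minus (minus (res u) (damped s (res u))) (scal s u)) <= s * eps.
Proof.
  intros hs hcont. apply le_epsilon. intros eta heta.
  set (w := res u). pose proof (norm_ge_0 u) as hu0.
  assert (hK : 0 < eta / (8 * M * M)).
  { apply Rdiv_lt_0_compat; trivial. assert (1 <= M * M) by nra. lra. }
  set (e := eta / (8 * M * M)) in *.
  destruct (proj1 (tends_eps _ _) (@res_tends u) e hK) as [N1 hN1].
  destruct (damped_continuous w hK) as (d & hd & hcw).
  destruct (inv2_pow_small hd) as [N2 hN2].
  destruct (@inv2_pow_small (eta / (8 * (norm u + 1)))) as [N3 hN3].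
  { apply Rdiv_lt_0_compat; lra. }
  set (n := (N1 + N2 + N3)%nat).
  specialize (hN1 n ltac:(unfold n; lia)). specialize (hN2 n ltac:(unfold n; lia)).
  specialize (hN3 n ltac:(unfold n; lia)).
  set (h := (/ 2) ^ n) in *. assert (hh : 0 < h) by apply inv2_pow_pos.
  set (x := laplace_sum h u) in *. fold w in hN1.
  destruct (nfloor_ex (s / h)) as [p [hp1 hp2]].
  { apply Rlt_le, Rdiv_lt_0_compat; lra. }
  set (t := INR p * h). set (r := s - t).
  assert (hs' : s = s / h * h) by (field; lra).
  assert (ht : 0 <= t <= s).
  { split; [apply Rmult_le_pos; [apply pos_INR|lra]|].
    rewrite hs'. apply Rmult_le_compat_r; lra. }
  assert (hr : 0 <= r < h).
  { unfold r. split; [lra|]. apply (Rmult_lt_compat_r h) in hp2; trivial.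
    rewrite <- hs' in hp2. unfold t. lra. }
  assert (ot : positive_op P 1 (damped t)) by (apply damped_op_1; lra).
  assert (or : positive_op P 1 (damped r)) by (apply damped_op_1; lra).
  assert (hx : minus x (damped t x) = scal h (psum (damped h) p u)).
  { assert (ho : positive_op P (exp (- lam * h)) (damped h)) by (apply damped_op; lra).
    unfold t. rewrite <- damped_iter by lra. rewrite <- (psum_diff p _ ho).
    assert (hq : minus x (damped h x) = scal h u).
    { unfold x, laplace_sum. rewrite (op_scal ho). rewrite <- (neumann_damped u hh) at 3. vec. }
    rewrite hq. apply (op_scal (op_psum hX p (Rlt_le _ _ (exp_pos _)) ho)). }
  assert (e1 : norm (minus (minus x (damped t x)) (scal t u)) <= t * eps).
  { rewrite hx.
    replace (minus (scal h (psum (damped h) p u)) (scal t u))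
      with (scal h (minus (psum (damped h) p u) (scal (INR p) u))) by (unfold t; vec).
    rewrite norm_scal_nonneg by lra.
    replace (t * eps) with (h * (INR p * eps)) by (unfold t; ring).
    apply Rmult_le_compat_l; [lra|]. apply psum_average.
    intros j hj. rewrite damped_iter by lra. apply hcont.
    apply lt_INR in hj. pose proof (pos_INR j). unfold t in ht. nra. }
  assert (hts : damped s w = damped t (damped r w)).
  { rewrite <- damped_add by lra. f_equal. unfold r. ring. }
  replace (minus (minus w (damped s w)) (scal s u)) with
    (plus (plus (minus (minus x (damped t x)) (scal t u)) (minus w x))
      (plus (damped t (plus (minus w (damped r w)) (minus x w)))
        (scal (-1) (scal r u)))).
  2:{ rewrite hts, (op_plus ot), !(op_minus _ _ ot). unfold r. vec. }
  specialize (hcw r ltac:(lra)). rewrite norm_minus_sym in hcw.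
  assert (e2 : norm (damped t (plus (minus w (damped r w)) (minus x w))) <= M * (e + e)).
  { eapply Rle_trans; [apply (op_bound hM _ Rle_0_1 ot)|]. rewrite Rmult_1_l.
    apply Rmult_le_compat_l; [lra|]. eapply Rle_trans; [apply norm_plus_le|]. lra. }
  assert (e3 : norm (scal (-1) (scal r u)) <= eta / 8).
  { eapply Rle_trans; [apply norm_scal_le|].
    replace (Rabs (-1)) with 1 by (rewrite Rabs_left; lra).
    rewrite Rmult_1_l, norm_scal_nonneg by lra.
    apply Rle_trans with (eta / (8 * (norm u + 1)) * (norm u + 1)).
    - apply Rmult_le_compat; lra.
    - right. field. lra. }
  assert (e4 : norm (minus w x) <= e) by (rewrite norm_minus_sym; lra).
  assert (e5 : e * (8 * M * M) = eta) by (unfold e; field; lra).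
  assert (e6 : 8 * (M * e) <= eta).
  { rewrite <- e5. assert (0 <= M * e) by (apply Rmult_le_pos; lra). nra. }
  assert (e7 : 8 * e <= 8 * (M * e)) by nra.
  assert (hep : 0 <= eps).
  { eapply Rle_trans; [|apply (hcont s); lra]. apply norm_ge_0. }
  assert (e8 : t * eps <= s * eps) by (apply Rmult_le_compat_r; lra).
  eapply Rle_trans; [apply norm_plus_le|].
  eapply Rle_trans; [apply Rplus_le_compat; apply norm_plus_le|].
  lra.
Qed.

(** The damped orbit of [res u] has derivative [- u] at [0]; undoing the damping by the factor
    [exp (lam s)] adds [lam (res u)]. *)
Lemma is_gen_res u : is_gen T (res u) (minus (scal lam (res u)) u).
Proof.
  apply is_gen_right_derivative.
  assert (h : has_right_derivative (fun s => damped s (res u)) (res u) (scal (-1) u)).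
  { intros eps he. destruct (damped_continuous u he) as (d & hd & hc).
    exists d. split; trivial. intros s hs.
    replace (minus (minus (damped s (res u)) (res u)) (scal s (scal (-1) u)))
      with (minus (scal s u) (minus (res u) (damped s (res u)))) by vec.
    rewrite norm_minus_sym, Rmult_comm. apply damped_res_estimate; [lra|].
    intros r hr. apply hc. lra. }
  apply (right_derivative_exp lam) in h.
  intros eps he. destruct (h eps he) as (d & hd & h'). exists d. split; trivial.
  intros s hs. specialize (h' s hs).
  replace (scal (exp (lam * s)) (damped s (res u))) with (T s (res u)) in h'.
  2:{ unfold damped.
      replace (scal (exp (lam * s)) (scal (exp (- lam * s)) (T s (res u))))
        with (scal (exp (lam * s) * exp (- lam * s)) (T s (res u))) by vec.
      rewrite <- exp_plus. replace (lam * s + - lam * s) with 0 by ring.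
      rewrite exp_0. vec. }
  replace (minus (scal lam (res u)) u) with (plus (scal (-1) u) (scal lam (res u))) by vec.
  easy.
Qed.

(** The vector [lam w - v] is the limit of the quotients [(w - damped h w) / h], which
    [laplace_sum h] maps exactly to [w]; uniform boundedness of [laplace_sum h] then suffices. *)
Lemma res_unique w v : is_gen T w v -> res (minus (scal lam w) v) = w.
Proof.
  intros hg. apply is_gen_right_derivative in hg.
  apply (right_derivative_exp (- lam)) in hg. set (u := minus (scal lam w) v).
  apply (tends_unique (@res_tends u)). apply tends_eps. intros eps he.
  pose proof laplace_const_nonneg as hC.
  assert (hCM : 0 <= C * M) by (apply Rmult_le_pos; lra).
  set (e := eps / (2 * (C * M + 1))).
  assert (he' : 0 < e) by (apply Rdiv_lt_0_compat; lra).
  destruct (hg e he') as (d & hd & hd'). destruct (inv2_pow_small hd) as [N hN].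
  exists N. intros n hn. specialize (hN n hn). pose proof (inv2_pow_pos n) as hp.
  pose proof (inv2_pow_le_1 n). set (h := (/ 2) ^ n) in *.
  specialize (hd' h (conj hp hN)).
  change (norm (minus (minus (damped h w) w) (scal h (plus v (scal (- lam) w)))) <= e * h) in hd'.
  assert (hE : positive_op P C (laplace_sum h)) by (apply op_laplace_sum_C; lra).
  rewrite <- (laplace_sum_eq w hp) at 1.
  eapply Rle_lt_trans; [apply (op_dist hM _ _ hC hE)|].
  apply Rle_lt_trans with (C * M * e).
  - apply Rmult_le_compat_l; trivial.
    replace (minus u (scal (/ h) (minus w (damped h w)))) with
      (scal (/ h) (minus (minus (damped h w) w) (scal h (plus v (scal (- lam) w)))))
      by (unfold u; vec; field; lra).
    rewrite norm_scal_nonneg by (left; now apply Rinv_0_lt_compat).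
    apply Rmult_le_reg_l with h; trivial.
    rewrite <- Rmult_assoc, Rinv_r, Rmult_1_l by lra. lra.
  - unfold e. apply Rmult_lt_reg_r with (2 * (C * M + 1)); [lra|].
    replace (C * M * (eps / (2 * (C * M + 1))) * (2 * (C * M + 1)))
      with (C * M * eps) by (field; lra). nra.
Qed.

Lemma resolvent_res u : resolvent T lam u = res u.
Proof.
  apply iota_unique.
  - intros w [hw hu]. rewrite <- hu. symmetry. apply res_unique. now apply gen_is_gen.
  - split.
    + exists (minus (scal lam (res u)) u). apply is_gen_res.
    + rewrite (gen_correct (@is_gen_res u)). vec.
Qed.

Lemma op_resolvent : positive_op P (/ lam) (resolvent T lam).
Proof.
  pose proof op_res as h. split; intros; rewrite !resolvent_res.
  - apply (op_plus h).
  - apply (op_scal h).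
  - now apply (op_pos h).
  - now apply (op_norm h).
Qed.

Lemma is_gen_resolvent u :
  is_gen T (resolvent T lam u) (minus (scal lam (resolvent T lam u)) u).
Proof. rewrite resolvent_res. apply is_gen_res. Qed.

Lemma resolvent_unique w v : is_gen T w v -> resolvent T lam (minus (scal lam w) v) = w.
Proof. rewrite resolvent_res. apply res_unique. Qed.

Lemma is_gen_orbit s w v : 0 <= s -> is_gen T w v -> is_gen T (T s w) (T s v).
Proof.
  intros hs hg. apply is_gen_right_derivative in hg. apply is_gen_right_derivative.
  pose proof (substochastic_op hs) as oT.
  intros eps he. destruct (hg (eps / M)) as (d & hd & h); [apply Rdiv_lt_0_compat; lra|].
  exists d. split; trivial. intros r hr. specialize (h r hr).
  rewrite <- (sg_add (sub_C0 hT)), Rplus_comm, (sg_add (sub_C0 hT)) by lra.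
  rewrite <- (op_scal oT), <- !(op_minus _ _ oT).
  eapply Rle_trans; [apply (op_bound hM _ Rle_0_1 oT)|]. rewrite Rmult_1_l.
  apply (Rmult_le_compat_l M) in h; [|lra].
  replace (M * (eps / M * r)) with (eps * r) in h by (field; lra). easy.
Qed.

(** If [w] is the resolvent of [u], then [u = lam w - v] with [v] the generator at [w]. Replacing
    [v] by the quotient [(T s w - w) / s] stays inside the domain, because orbits of domain vectors
    do. *)
Lemma resolvent_dense u eps : 0 < eps ->
  exists z, norm (minus u (resolvent T lam z)) < eps.
Proof.
  intros he. set (w := resolvent T lam u). set (v := minus (scal lam w) u).
  pose proof (@is_gen_resolvent u) as hg. fold w in hg. fold v in hg.
  pose proof (proj1 (is_gen_right_derivative T w v) hg) as hd.
  destruct (hd (eps / 2)) as (d & hd0 & h); [lra|].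
  set (s := d / 2). specialize (h s ltac:(unfold s; lra)).
  assert (hs : 0 < s) by (unfold s; lra).
  assert (hTs : T s w = resolvent T lam (minus (scal lam (T s w)) (T s v))).
  { symmetry. apply resolvent_unique. apply is_gen_orbit; trivial. lra. }
  set (y := minus (scal lam (T s w)) (T s v)) in *.
  (* Since the resolvent sends [u] to [w] and [y] to [T s w], it sends this vector to
     [lam w - (T s w - w) / s]. *)
  exists (minus (scal lam u) (scal (/ s) (minus y u))).
  rewrite (op_minus _ _ op_resolvent), !(op_scal op_resolvent), (op_minus _ _ op_resolvent).
  rewrite <- hTs. fold w.
  replace (minus u (minus (scal lam w) (scal (/ s) (minus (T s w) w))))
    with (scal (/ s) (minus (minus (T s w) w) (scal s v))) by (unfold v; vec; field; lra).
  rewrite norm_scal_nonneg by (left; now apply Rinv_0_lt_compat).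
  apply Rmult_lt_reg_l with s; trivial. rewrite <- Rmult_assoc, Rinv_r, Rmult_1_l by lra.
  nra.
Qed.

End Resolvent.

Section Comparison.
Import VectorOperations.

(** The order passes to powers and partial sums of the damped operators, and closedness of the cone
    carries it through the two limits that define the resolvent. *)
Lemma resolvent_mono (X : RBanach) (P : X -> Prop) (M : R) (T T' : R -> X -> X) (lam : R)
  (u : X) : is_abstract_state_space P -> 1 <= M ->
  (forall v : X, cone_cost P (M * norm v) v) ->
  is_substochastic P T -> is_substochastic P T' -> 0 < lam ->
  (forall t, 0 <= t -> forall v, P v -> ole P (T t v) (T' t v)) -> P u ->
  ole P (resolvent T lam u) (resolvent T' lam u).
Proof.
  intros hX hM1 hM hT hT' hl hle hu.
  rewrite (resolvent_res hX hM1 hM hT hl), (resolvent_res hX hM1 hM hT' hl).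
  apply (cone_tends hX (x := fun n => minus (laplace_sum T' lam ((/ 2) ^ n) u) (laplace_sum T lam ((/ 2) ^ n) u))).
  2:{ apply tends_minus; [exact (res_tends hX hM1 hM hT' hl (u := u))|
                          exact (res_tends hX hM1 hM hT hl (u := u))]. }
  intros n. pose proof (inv2_pow_pos n) as hh. set (h := (/ 2) ^ n) in *.
  assert (hh0 : 0 <= h) by lra.
  pose proof (damped_op hX hT lam hh0) as o. pose proof (damped_op hX hT' lam hh0) as o'.
  pose proof (damped_factor hl hh) as hc.
  unfold laplace_sum.
  replace (minus (scal h (neumann (damped T' lam h) u)) (scal h (neumann (damped T lam h) u)))
    with (scal h (minus (neumann (damped T' lam h) u) (neumann (damped T lam h) u))) by vec.
  apply (cone_scal hX); trivial.
  apply (cone_tends hX (x := fun m => minus (psum (damped T' lam h) m u) (psum (damped T lam h) m u))).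
  2:{ apply tends_minus; [exact (psum_tends hX hc o' (u := u))|
                          exact (psum_tends hX hc o (u := u))]. }
  intros m. apply (psum_mono hX m o o'); trivial. intros v hv. unfold damped.
  replace (minus (scal (exp (- lam * h)) (T' h v)) (scal (exp (- lam * h)) (T h v)))
    with (scal (exp (- lam * h)) (minus (T' h v) (T h v))) by vec.
  apply (cone_scal hX); [left; apply exp_pos|]. now apply hle.
Qed.

End Comparison.

(** * The perturbation series *)

Section Perturbation.
Import VectorOperations.
Context (X : RBanach) (P : X -> Prop) (hX : is_abstract_state_space P).
Context (M : R) (hM1 : 1 <= M) (hM : forall u : X, cone_cost P (M * norm u) u).
Implicit Types (u v w : X) (lam mu : R).

(* To be applied with [L lam] the resolvent of the unperturbed generator and
   [K lam = B (L lam)]. *)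
Context (L K : R -> X -> X).
Context (hL : forall lam, 0 < lam -> positive_op P (/ lam) (L lam)).
Context (hK : forall lam, 0 < lam -> positive_op P 1 (K lam)).
Context (hLK : forall lam u, 0 < lam -> P u ->
  lam * norm (L lam u) + norm (K lam u) <= norm u).
Context (hL_res : forall lam mu u, 0 < lam -> 0 < mu ->
  L lam u = plus (L mu u) (scal (mu - lam) (L lam (L mu u)))).
Context (hK_res : forall lam mu u, 0 < lam -> 0 < mu ->
  K lam u = plus (K mu u) (scal (mu - lam) (K lam (L mu u)))).

Definition pseries lam u : X := vlim (fun n => L lam (psum (K lam) n u)).

(** [hLK] telescopes along the iterates because the norms of the terms add on the cone. This bounds
    the partial sums by [/ lam] uniformly in [n], although [K lam] brings no geometric decay. *)
Lemma partial_norm lam n u : 0 < lam -> P u ->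
  lam * norm (L lam (psum (K lam) n u)) + norm (Nat.iter n (K lam) u) <= norm u.
Proof.
  intros hl hu. pose proof (hK hl) as hKl. pose proof (hL hl) as hLl.
  induction n as [|n IH].
  - simpl. rewrite (op_zero hLl), norm_of_zero. lra.
  - simpl. rewrite (op_plus hLl).
    assert (hi : P (Nat.iter n (K lam) u)) by exact (op_pos (op_iter_one n hKl) hu).
    assert (hs : P (psum (K lam) n u)) by exact (op_pos (op_psum hX n Rle_0_1 hKl) hu).
    rewrite (norm_add hX) by (now apply (op_pos hLl)).
    pose proof (hLK hl hi). lra.
Qed.

Lemma op_partial lam n : 0 < lam ->
  positive_op P (/ lam) (fun u => L lam (psum (K lam) n u)).
Proof.
  intros hl. assert (hi : 0 < / lam) by now apply Rinv_0_lt_compat.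
  pose proof (op_comp (Rlt_le _ _ hi) (hL hl) (op_psum hX n Rle_0_1 (hK hl))) as h.
  split; try apply h. intros u hu. pose proof (partial_norm n hl hu) as hn.
  pose proof (norm_ge_0 (Nat.iter n (K lam) u)).
  apply Rmult_le_reg_l with lam; trivial. rewrite <- Rmult_assoc, Rinv_r; lra.
Qed.

Lemma partial_increasing lam n u : 0 < lam -> P u ->
  P (minus (L lam (psum (K lam) (S n) u)) (L lam (psum (K lam) n u))).
Proof.
  intros hl hu. simpl. rewrite (op_plus (hL hl)).
  replace (minus (plus (L lam (psum (K lam) n u)) (L lam (Nat.iter n (K lam) u)))
    (L lam (psum (K lam) n u))) with (L lam (Nat.iter n (K lam) u)) by vec.
  apply (op_pos (hL hl)). exact (op_pos (op_iter_one n (hK hl)) hu).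
Qed.

Lemma pseries_tends lam u : 0 < lam ->
  tends (fun n => L lam (psum (K lam) n u)) (pseries lam u).
Proof.
  intros hl. apply (op_limit_exists hX (F := fun n u => L lam (psum (K lam) n u))
    (fun n => op_partial n hl)).
  clear u. intros u hu. apply (increasing_tends hX) with (/ lam * norm u).
  - simpl. rewrite (op_zero (hL hl)). apply (cone_zero hX).
  - intros n. now apply partial_increasing.
  - intros n. exact (op_norm (op_partial n hl) hu).
Qed.

Lemma op_pseries lam : 0 < lam -> positive_op P (/ lam) (pseries lam).
Proof.
  intros hl. apply (op_limit hX (fun n => op_partial n hl)).
  intros u. now apply pseries_tends.
Qed.

Lemma pseries_step lam u : 0 < lam ->
  pseries lam u = plus (L lam u) (pseries lam (K lam u)).
Proof.
  intros hl. apply (tends_unique (tends_S (@pseries_tends lam u hl))).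
  apply (tends_ext (x := fun n => plus (L lam u) (L lam (psum (K lam) n (K lam u))))).
  - intros n. rewrite (psum_shift n u (hK hl)). symmetry. apply (op_plus (hL hl)).
  - apply tends_plus; [apply tends_const|now apply pseries_tends].
Qed.

Lemma pseries_iter lam n u : 0 < lam ->
  pseries lam (Nat.iter n (K lam) u)
  = minus (pseries lam u) (L lam (psum (K lam) n u)).
Proof.
  intros hl. induction n as [|n IH].
  - simpl. rewrite (op_zero (hL hl)). vec.
  - rewrite (pseries_step (Nat.iter n (K lam) u) hl) in IH. simpl.
    rewrite (op_plus (hL hl)).
    replace (pseries lam (K lam (Nat.iter n (K lam) u))) with
      (minus (plus (L lam (Nat.iter n (K lam) u))
        (pseries lam (K lam (Nat.iter n (K lam) u)))) (L lam (Nat.iter n (K lam) u))) by vec.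
    rewrite IH. vec.
Qed.

(** These vectors are the tails of a convergent series. The iterates of [K lam] themselves may keep
    a positive mass. *)
Lemma pseries_iter_tends lam u : 0 < lam ->
  tends (fun n => pseries lam (Nat.iter n (K lam) u)) zero.
Proof.
  intros hl.
  apply (tends_ext (x := fun n => minus (pseries lam u) (L lam (psum (K lam) n u)))).
  - intros n. symmetry. now apply pseries_iter.
  - rewrite <- (minus_self (pseries lam u)).
    exact (tends_minus (@tends_const X (pseries lam u)) (@pseries_tends lam u hl)).
Qed.

Lemma K_antitone lam mu u : 0 < lam -> lam <= mu -> P u ->
  P (minus (K lam u) (K mu u)).
Proof.
  intros hl hlm hu. assert (hm : 0 < mu) by lra. rewrite (hK_res u hl hm).
  replace (minus (plus (K mu u) (scal (mu - lam) (K lam (L mu u)))) (K mu u))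
    with (scal (mu - lam) (K lam (L mu u))) by vec.
  apply (cone_scal hX); [lra|]. now apply (op_pos (hK hl)), (op_pos (hL hm)).
Qed.

Lemma K_iter_antitone lam mu n u : 0 < lam -> lam <= mu -> P u ->
  P (minus (Nat.iter n (K lam) u) (Nat.iter n (K mu) u)).
Proof.
  intros hl hlm hu. assert (hm : 0 < mu) by lra.
  apply (op_iter_mono hX n (hK hm) (hK hl)); trivial.
  intros v hv. now apply K_antitone.
Qed.

(** * The resolvent identity for the perturbation series *)

Definition resolvent_defect lam mu u : X :=
  minus (minus (pseries lam u) (pseries mu u))
    (scal (mu - lam) (pseries lam (pseries mu u))).

(* The defect is unchanged by [K mu], hence equals its limit [0] along the iterates. *)
Lemma resolvent_defect_step lam mu u : 0 < lam -> 0 < mu ->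
  resolvent_defect lam mu u = resolvent_defect lam mu (K mu u).
Proof.
  intros hl hm. pose proof (op_pseries hl) as hS. unfold resolvent_defect.
  rewrite (pseries_step u hm), (op_plus hS (L mu u)).
  rewrite (pseries_step u hl), (pseries_step (L mu u) hl).
  rewrite (hL_res u hl hm), (hK_res u hl hm).
  rewrite (op_plus hS (K mu u)), (op_scal hS). vec.
Qed.

Lemma resolvent_defect_zero lam mu u : 0 < lam -> 0 < mu ->
  tends (fun n => pseries lam (Nat.iter n (K mu) u)) zero ->
  resolvent_defect lam mu u = zero.
Proof.
  intros hl hm hz.
  assert (hconst : forall n, resolvent_defect lam mu (Nat.iter n (K mu) u)
    = resolvent_defect lam mu u).
  { intros n. induction n as [|n IH]; trivial. simpl.
    now rewrite <- resolvent_defect_step. }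
  apply (tends_unique (x := fun _ => resolvent_defect lam mu u)); [apply tends_const|].
  apply (tends_ext hconst). unfold resolvent_defect.
  assert (hi : 0 <= / lam) by (left; now apply Rinv_0_lt_compat).
  assert (h0 : minus (minus zero zero) (scal (mu - lam) (pseries lam zero)) = zero).
  { rewrite (op_zero (op_pseries hl)). vec. }
  rewrite <- h0. apply tends_minus; [apply tends_minus; trivial|apply tends_scal].
  - now apply pseries_iter_tends.
  - apply (op_tends hM hi (op_pseries hl)). now apply pseries_iter_tends.
Qed.

Lemma tends_zero_dominated (x y : nat -> X) :
  (forall n, P (x n)) -> (forall n, P (minus (y n) (x n))) ->
  tends y zero -> tends x zero.
Proof.
  intros hx hxy hy. apply tends_squeeze with (fun n => norm (minus (y n) zero)).
  - intros n. replace (minus (x n) zero) with (x n) by vec.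
    replace (minus (y n) zero) with (y n) by vec. now apply (norm_mono hX).
  - now apply tends_norm.
Qed.

(** On the cone the iterates of [K mu] lie below those of [K lam], so the tails with matching
    parameters dominate. *)
Lemma pseries_K_tends_le lam mu u : 0 < lam -> lam <= mu -> P u ->
  tends (fun n => pseries lam (Nat.iter n (K mu) u)) zero.
Proof.
  intros hl hlm hu. assert (hm : 0 < mu) by lra.
  apply (@tends_zero_dominated _ (fun n => pseries lam (Nat.iter n (K lam) u))).
  - intros n. apply (op_pos (op_pseries hl)). exact (op_pos (op_iter_one n (hK hm)) hu).
  - intros n. apply (op_mono (op_pseries hl)). now apply K_iter_antitone.
  - now apply pseries_iter_tends.
Qed.

Lemma pseries_antitone lam mu u : 0 < lam -> lam <= mu -> P u ->
  P (minus (pseries lam u) (pseries mu u)).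
Proof.
  intros hl hlm hu. assert (hm : 0 < mu) by lra.
  pose proof (resolvent_defect_zero hl hm (pseries_K_tends_le hl hlm hu)) as h.
  replace (minus (pseries lam u) (pseries mu u)) with
    (plus (resolvent_defect lam mu u) (scal (mu - lam) (pseries lam (pseries mu u))))
    by (unfold resolvent_defect; vec).
  rewrite h.
  replace (plus zero (scal (mu - lam) (pseries lam (pseries mu u))))
    with (scal (mu - lam) (pseries lam (pseries mu u))) by vec.
  apply (cone_scal hX); [lra|]. now apply (op_pos (op_pseries hl)), (op_pos (op_pseries hm)).
Qed.

(** For [mu < lam] the domination comes from [pseries lam <= pseries mu], itself a consequence of
    the identity in the other ordering of the parameters; hence the two stages. *)
Lemma pseries_K_tends lam mu u : 0 < lam -> 0 < mu -> P u ->
  tends (fun n => pseries lam (Nat.iter n (K mu) u)) zero.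
Proof.
  intros hl hm hu. destruct (Rle_dec lam mu) as [h|h]; [now apply pseries_K_tends_le|].
  assert (hi : forall n, P (Nat.iter n (K mu) u)).
  { intros n. exact (op_pos (op_iter_one n (hK hm)) hu). }
  apply (@tends_zero_dominated _ (fun n => pseries mu (Nat.iter n (K mu) u))).
  - intros n. now apply (op_pos (op_pseries hl)).
  - intros n. apply pseries_antitone; trivial. lra.
  - now apply pseries_iter_tends.
Qed.

Lemma pseries_res lam mu u : 0 < lam -> 0 < mu ->
  pseries lam u = plus (pseries mu u) (scal (mu - lam) (pseries lam (pseries mu u))).
Proof.
  intros hl hm. pose proof (op_pseries hl) as hSl. pose proof (op_pseries hm) as hSm.
  assert (hcone : forall v, P v ->
    pseries lam v = plus (pseries mu v) (scal (mu - lam) (pseries lam (pseries mu v)))).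
  { intros v hv.
    pose proof (resolvent_defect_zero hl hm (pseries_K_tends hl hm hv)) as h.
    replace (pseries lam v) with (plus (resolvent_defect lam mu v)
      (plus (pseries mu v) (scal (mu - lam) (pseries lam (pseries mu v)))))
      by (unfold resolvent_defect; vec).
    rewrite h. vec. }
  destruct (ass_generating hX u) as (v & w & hv & hw & hu).
  assert (hu' : u = minus v w) by exact hu. rewrite hu'.
  rewrite (op_minus _ _ hSm), !(op_minus _ _ hSl), (hcone v hv), (hcone w hw). vec.
Qed.

(** * The limit functional of the iterates *)

Context (Psi : X -> R) (hPsi : is_norm_functional P Psi).

Lemma Psi_plus u v : Psi (plus u v) = Psi u + Psi v.
Proof. exact (linear_plus _ (proj1 hPsi) u v). Qed.

Lemma Psi_scal r u : Psi (scal r u) = r * Psi u.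
Proof. exact (linear_scal _ (proj1 hPsi) r u). Qed.

Lemma Psi_minus u v : Psi (minus u v) = Psi u - Psi v.
Proof.
  replace (minus u v) with (plus u (scal (-1) v)) by vec.
  rewrite Psi_plus, Psi_scal. ring.
Qed.

Lemma Psi_norm u : P u -> Psi u = norm u.
Proof. apply hPsi. Qed.

Lemma Psi_bounded : exists C, forall u, Rabs (Psi u) <= C * norm u.
Proof. destruct (linear_norm _ (proj1 hPsi)) as (C & _ & h). now exists C. Qed.

Lemma Psi_tends (x : nat -> X) u : tends x u -> is_lim_seq (fun n => Psi (x n)) (Psi u).
Proof.
  intros hx. destruct Psi_bounded as [C hC].
  apply is_lim_seq_spec. intros [eps he]. simpl.
  destruct (proj1 (tends_eps x u) hx (eps / (Rabs C + 1))) as [N hN].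
  { apply Rdiv_lt_0_compat; trivial. pose proof (Rabs_pos C). lra. }
  exists N. intros n hn. specialize (hN n hn). rewrite <- Psi_minus.
  eapply Rle_lt_trans; [apply hC|]. pose proof (Rabs_pos C). pose proof (Rle_abs C).
  apply (Rmult_lt_compat_l (Rabs C + 1)) in hN; [|lra].
  replace ((Rabs C + 1) * (eps / (Rabs C + 1))) with eps in hN by (field; lra).
  pose proof (norm_ge_0 (minus (x n) u)). nra.
Qed.

Definition defect lam u : R := real (Lim_seq (fun n => Psi (Nat.iter n (K lam) u))).

Lemma K_iter_minus lam n u v : 0 < lam ->
  Nat.iter n (K lam) (minus u v) = minus (Nat.iter n (K lam) u) (Nat.iter n (K lam) v).
Proof. intros hl. exact (op_minus u v (op_iter_one n (hK hl))). Qed.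

(** On the cone [Psi] is the norm and [K lam] does not increase it, so the sequence decreases to a
    limit; differences of cone vectors give the rest. *)
Lemma defect_lim lam u : 0 < lam ->
  is_lim_seq (fun n => Psi (Nat.iter n (K lam) u)) (defect lam u).
Proof.
  intros hl. apply Lim_seq_correct'.
  assert (hcone : forall v, P v -> ex_finite_lim_seq (fun n => Psi (Nat.iter n (K lam) v))).
  { intros v hv.
    assert (hi : forall n, P (Nat.iter n (K lam) v)).
    { intros n. exact (op_pos (op_iter_one n (hK hl)) hv). }
    apply ex_finite_lim_seq_decr with 0.
    - intros n. rewrite !Psi_norm by trivial. simpl.
      pose proof (op_norm (hK hl) (hi n)). lra.
    - intros n. rewrite Psi_norm by trivial. apply norm_ge_0. }
  destruct (ass_generating hX u) as (v & w & hv & hw & hu).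
  assert (hu' : u = minus v w) by exact hu. rewrite hu'.
  destruct (hcone v hv) as [a ha]. destruct (hcone w hw) as [b hb].
  exists (a - b). apply (is_lim_seq_ext
    (fun n => Psi (Nat.iter n (K lam) v) - Psi (Nat.iter n (K lam) w))).
  - intros n. now rewrite K_iter_minus, Psi_minus.
  - now apply is_lim_seq_minus'.
Qed.

Lemma defect_unique lam u (l : R) : 0 < lam ->
  is_lim_seq (fun n => Psi (Nat.iter n (K lam) u)) l -> defect lam u = l.
Proof.
  intros hl h. pose proof (is_lim_seq_unique _ _ h) as h1.
  unfold defect. now rewrite h1.
Qed.

Lemma defect_plus lam u v : 0 < lam -> defect lam (plus u v) = defect lam u + defect lam v.
Proof.
  intros hl. apply defect_unique; trivial.
  apply (is_lim_seq_ext (fun n => Psi (Nat.iter n (K lam) u) + Psi (Nat.iter n (K lam) v))).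
  - intros n. rewrite (op_plus (op_iter_one n (hK hl))). symmetry. apply Psi_plus.
  - apply is_lim_seq_plus'; now apply defect_lim.
Qed.

Lemma defect_scal lam r u : 0 < lam -> defect lam (scal r u) = r * defect lam u.
Proof.
  intros hl. apply defect_unique; trivial.
  apply (is_lim_seq_ext (fun n => r * Psi (Nat.iter n (K lam) u))).
  - intros n. rewrite (op_scal (op_iter_one n (hK hl))). symmetry. apply Psi_scal.
  - apply (is_lim_seq_scal_l _ r (defect lam u)). now apply defect_lim.
Qed.

Lemma defect_minus lam u v : 0 < lam -> defect lam (minus u v) = defect lam u - defect lam v.
Proof.
  intros hl. replace (minus u v) with (plus u (scal (-1) v)) by vec.
  rewrite defect_plus, defect_scal by trivial. ring.
Qed.

Lemma defect_nonneg lam u : 0 < lam -> P u -> 0 <= defect lam u.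
Proof.
  intros hl hu.
  refine (is_lim_seq_le (fun _ => 0) _ 0 _ _ (is_lim_seq_const 0) (@defect_lim lam u hl)).
  intros n. rewrite Psi_norm by exact (op_pos (op_iter_one n (hK hl)) hu).
  apply norm_ge_0.
Qed.

(** All iterates of [K lam] share the bound [M] on the whole space, and it survives in the limit.
    This gives the continuity of the functional. *)
Lemma defect_bound lam u : 0 < lam -> exists C, forall v,
  Rabs (defect lam v - defect lam u) <= C * norm (minus v u).
Proof.
  intros hl. destruct Psi_bounded as [C hC].
  assert (hC0 : forall v, 0 <= C * norm v).
  { intros v. eapply Rle_trans; [apply Rabs_pos|apply hC]. }
  assert (hb : forall v n, Rabs (Psi (Nat.iter n (K lam) v)) <= M * (C * norm v)).
  { intros v n. eapply Rle_trans; [apply hC|].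
    destruct (Rle_dec 0 C) as [h|h].
    - replace (M * (C * norm v)) with (C * (M * norm v)) by ring.
      apply Rmult_le_compat_l; trivial. exact (op_iter_bound hM n v (hK hl)).
    - pose proof (norm_ge_0 (Nat.iter n (K lam) v)). pose proof (hC0 v).
      apply Rle_trans with 0; [nra|apply Rmult_le_pos; lra]. }
  exists (M * C). intros v. rewrite <- defect_minus by trivial.
  pose proof (hb (minus v u)) as h. set (z := minus v u) in *.
  apply Rabs_le. split.
  - refine (is_lim_seq_le (fun _ => - (M * C * norm z)) _ (- (M * C * norm z)) _ _
      (is_lim_seq_const _) (@defect_lim lam z hl)).
    intros n. specialize (h n). apply Rabs_le_between in h. lra.
  - refine (is_lim_seq_le _ (fun _ => M * C * norm z) _ (M * C * norm z) _
      (@defect_lim lam z hl) (is_lim_seq_const _)).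
    intros n. specialize (h n). apply Rabs_le_between in h. lra.
Qed.

Lemma defect_tends lam (x : nat -> X) u : 0 < lam -> tends x u ->
  is_lim_seq (fun n => defect lam (x n)) (defect lam u).
Proof.
  intros hl hx. destruct (@defect_bound lam u hl) as [C hC].
  apply is_lim_seq_spec. intros [eps he]. simpl.
  assert (hC' : forall v, Rabs (defect lam v - defect lam u) <= (Rabs C + 1) * norm (minus v u)).
  { intros v. specialize (hC v). pose proof (norm_ge_0 (minus v u)).
    pose proof (Rle_abs C). nra. }
  pose proof (Rabs_pos C).
  destruct (proj1 (tends_eps x u) hx (eps / (Rabs C + 1))) as [N hN].
  { apply Rdiv_lt_0_compat; lra. }
  exists N. intros n hn. specialize (hN n hn). eapply Rle_lt_trans; [apply hC'|].
  apply (Rmult_lt_compat_l (Rabs C + 1)) in hN; [|lra].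
  replace ((Rabs C + 1) * (eps / (Rabs C + 1))) with eps in hN by (field; lra). easy.
Qed.

Lemma defect_K lam u : 0 < lam -> defect lam (K lam u) = defect lam u.
Proof.
  intros hl. apply defect_unique; trivial.
  apply (is_lim_seq_ext (fun n => Psi (Nat.iter (S n) (K lam) u))).
  - intros n. now rewrite Nat.iter_succ_r.
  - apply (is_lim_seq_incr_1 (fun n => Psi (Nat.iter n (K lam) u))).
    now apply defect_lim.
Qed.

Lemma defect_antitone lam mu u : 0 < lam -> lam <= mu -> P u ->
  defect mu u <= defect lam u.
Proof.
  intros hl hlm hu. assert (hm : 0 < mu) by lra.
  refine (is_lim_seq_le _ _ _ _ _ (@defect_lim mu u hm) (@defect_lim lam u hl)).
  intros n. rewrite !Psi_norm.
  - apply (norm_mono hX); [exact (op_pos (op_iter_one n (hK hm)) hu)|].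
    now apply K_iter_antitone.
  - exact (op_pos (op_iter_one n (hK hl)) hu).
  - exact (op_pos (op_iter_one n (hK hm)) hu).
Qed.

(** As [defect lam] is invariant under [K lam], applying it to [hK_res] gives [defect lam v = defect
    lam (K mu v) + (mu - lam) defect lam (L mu v)]; this is summed over [v = (K mu)^j u]. *)
Lemma defect_expand lam mu n u : 0 < lam -> 0 < mu ->
  defect lam u = defect lam (Nat.iter n (K mu) u)
    + (mu - lam) * defect lam (L mu (psum (K mu) n u)).
Proof.
  intros hl hm. induction n as [|n IH].
  - simpl. rewrite (op_zero (hL hm)).
    assert (h : defect lam zero = 0).
    { replace (zero : X) with (scal 0 (zero : X)) by vec. rewrite defect_scal; lra. }
    rewrite h. ring.
  - rewrite IH. simpl. rewrite (op_plus (hL hm)), (defect_plus _ _ hl).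
    rewrite <- (defect_K (Nat.iter n (K mu) u) hl).
    rewrite (hK_res (Nat.iter n (K mu) u) hl hm).
    rewrite (defect_plus _ _ hl), (defect_scal _ _ hl), (defect_K _ hl). ring.
Qed.

(** The first term of [defect_expand] is nonnegative and is dropped before [n] goes to infinity.
    This inequality makes the null cone stable under [pseries mu]. *)
Lemma defect_pseries lam mu u : 0 < lam -> lam <= mu -> P u ->
  (mu - lam) * defect lam (pseries mu u) <= defect lam u.
Proof.
  intros hl hlm hu. assert (hm : 0 < mu) by lra.
  refine (is_lim_seq_le (fun n => (mu - lam) * defect lam (L mu (psum (K mu) n u)))
    (fun _ => defect lam u) ((mu - lam) * defect lam (pseries mu u)) (defect lam u)
    _ _ (is_lim_seq_const _)).
  - intros n. rewrite (defect_expand n u hl hm).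
    pose proof (defect_nonneg hl (op_pos (op_iter_one n (hK hm)) hu)). simpl in *. lra.
  - apply (is_lim_seq_scal_l _ _ (defect lam (pseries mu u))).
    apply defect_tends; trivial. now apply pseries_tends.
Qed.

(** * The common null cone of the limit functionals *)

Definition null_cone u : Prop := P u /\ forall lam, 0 < lam -> defect lam u = 0.

Lemma null_cone_closed : closed null_cone.
Proof.
  apply tends_closed. intros x u hx hu. split.
  - apply (cone_tends hX (x := x)); trivial. apply hx.
  - intros lam hl. pose proof (defect_tends hl hu) as h.
    apply (is_lim_seq_ext _ (fun _ => 0)) in h; [|intros n; now apply hx].
    pose proof (is_lim_seq_unique _ _ h) as h1.
    rewrite Lim_seq_const in h1. now injection h1.
Qed.

Lemma null_cone_is_subcone : is_subcone P null_cone.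
Proof.
  split; [split; [|split]|].
  - split; [apply (cone_zero hX)|]. intros lam hl.
    replace (Hierarchy.zero : X) with (scal 0 (zero : X)) by vec.
    rewrite defect_scal; lra.
  - intros u v [hu hu'] [hv hv']. split; [now apply (cone_plus hX)|].
    intros lam hl. rewrite defect_plus, hu', hv' by trivial. ring.
  - intros r u hr [hu hu']. split; [now apply (cone_scal hX)|].
    intros lam hl. rewrite defect_scal, hu' by trivial. ring.
  - now intros u [hu _].
Qed.

Lemma null_cone_hereditary u v : P u -> P (minus v u) -> null_cone v -> null_cone u.
Proof.
  intros hu huv [hv hv']. split; trivial. intros lam hl.
  pose proof (defect_nonneg hl hu). pose proof (defect_nonneg hl huv) as h.
  rewrite defect_minus, hv' in h by trivial. lra.
Qed.

Lemma null_cone_pseries mu u : 0 < mu -> null_cone u -> null_cone (pseries mu u).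
Proof.
  intros hm [hu hu']. assert (hp : P (pseries mu u)) by now apply (op_pos (op_pseries hm)).
  split; trivial. intros nu hn.
  (* [defect_pseries] forces a zero only where [mu - lam > 0], so [lam] is taken strictly below
     [mu]; being also below [nu], it passes the zero on by [defect_antitone]. *)
  set (lam := Rmin nu mu / 2).
  assert (hmin : 0 < Rmin nu mu) by now apply Rmin_glb_lt.
  assert (hl : 0 < lam) by (unfold lam; lra).
  pose proof (Rmin_l nu mu). pose proof (Rmin_r nu mu).
  assert (h1 : lam <= nu) by (unfold lam; lra).
  assert (h2 : lam < mu) by (unfold lam; lra).
  pose proof (defect_pseries hl (Rlt_le _ _ h2) hu) as h3. rewrite hu' in h3 by easy.
  pose proof (defect_antitone hl h1 hp).
  pose proof (defect_nonneg hn hp). pose proof (defect_nonneg hl hp). nra.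
Qed.

End Perturbation.

(** * Generation theorem by dyadic Euler steps *)

Definition dyadic_floor (t : R) (n : nat) : nat := Z.to_nat (Int_part (t * 2 ^ n)).

Lemma dyadic_floor_spec (t : R) (n : nat) : 0 <= t ->
  INR (dyadic_floor t n) <= t * 2 ^ n < INR (dyadic_floor t n) + 1.
Proof.
  intros ht. assert (h : 0 <= t * 2 ^ n) by (apply Rmult_le_pos; [easy|apply pow_le; lra]).
  unfold dyadic_floor. destruct (base_Int_part (t * 2 ^ n)) as [h1 h2].
  assert (h3 : (0 <= Int_part (t * 2 ^ n))%Z).
  { apply Z.lt_succ_r, lt_IZR. rewrite succ_IZR. simpl. lra. }
  rewrite INR_IZR_INZ, Z2Nat.id by easy. lra.
Qed.

Lemma pow2_inv2 (n : nat) : 2 ^ n * (/ 2) ^ n = 1.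
Proof. rewrite <- Rpow_mult_distr. replace (2 * / 2) with 1 by field. apply pow1. Qed.

Lemma dyadic_floor_time (t : R) (n : nat) : 0 <= t ->
  INR (dyadic_floor t n) * (/ 2) ^ n <= t < INR (dyadic_floor t n) * (/ 2) ^ n + (/ 2) ^ n.
Proof.
  intros ht. destruct (dyadic_floor_spec n ht) as [h1 h2].
  pose proof (inv2_pow_pos n). pose proof (pow2_inv2 n) as h3.
  assert (h4 : t = t * 2 ^ n * (/ 2) ^ n) by (rewrite Rmult_assoc, h3; ring).
  rewrite h4 at 2 3. split; nra.
Qed.

Lemma dyadic_floor_0 (n : nat) : dyadic_floor 0 n = O.
Proof.
  destruct (dyadic_floor_spec n (Rle_refl 0)) as [h _]. rewrite Rmult_0_l in h.
  assert (h' : (dyadic_floor 0 n <= 0)%nat) by now apply INR_le. lia.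
Qed.

(** [e] is the next binary digit of [t]: halving the step doubles the number of steps, up to one. *)
Lemma dyadic_floor_S (t : R) (n : nat) : 0 <= t ->
  exists e, (e <= 1)%nat /\ dyadic_floor t (S n) = (e + 2 * dyadic_floor t n)%nat.
Proof.
  intros ht. destruct (dyadic_floor_spec n ht) as [h1 h2].
  destruct (dyadic_floor_spec (S n) ht) as [h3 h4]. simpl pow in h3, h4.
  assert (h5 : (2 * dyadic_floor t n < S (dyadic_floor t (S n)))%nat).
  { apply INR_lt. rewrite S_INR, mult_INR. simpl (INR 2). lra. }
  assert (h6 : (dyadic_floor t (S n) < 2 * dyadic_floor t n + 2)%nat).
  { apply INR_lt. rewrite plus_INR, mult_INR. simpl (INR 2). lra. }
  exists (dyadic_floor t (S n) - 2 * dyadic_floor t n)%nat. lia.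
Qed.

Lemma dyadic_floor_add (s t : R) (n : nat) : 0 <= s -> 0 <= t ->
  exists e, (e <= 1)%nat /\
    dyadic_floor (s + t) n = (dyadic_floor s n + (dyadic_floor t n + e))%nat.
Proof.
  intros hs ht. destruct (dyadic_floor_spec n hs) as [h1 h2].
  destruct (dyadic_floor_spec n ht) as [h3 h4].
  destruct (@dyadic_floor_spec (s + t) n) as [h5 h6]; [lra|].
  assert (h7 : (dyadic_floor s n + dyadic_floor t n < S (dyadic_floor (s + t) n))%nat).
  { apply INR_lt. rewrite S_INR, plus_INR. lra. }
  assert (h8 : (dyadic_floor (s + t) n < dyadic_floor s n + dyadic_floor t n + 2)%nat).
  { apply INR_lt. rewrite !plus_INR. simpl (INR 2). lra. }
  exists (dyadic_floor (s + t) n - dyadic_floor s n - dyadic_floor t n)%nat. lia.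
Qed.

Section Generation.
Import VectorOperations.
Context (X : RBanach) (P : X -> Prop) (hX : is_abstract_state_space P).
Context (M : R) (hM1 : 1 <= M) (hM : forall u : X, cone_cost P (M * norm u) u).
Implicit Types (u v w x y z : X) (lam mu h : R).
Context (S : R -> X -> X).
Context (hS : forall lam, 0 < lam -> positive_op P (/ lam) (S lam)).
Context (hS_res : forall lam mu u, 0 < lam -> 0 < mu ->
  S lam u = plus (S mu u) (scal (mu - lam) (S lam (S mu u)))).
Context (hS_dense : forall u eps, 0 < eps -> exists v, norm (minus u (S 1 v)) < eps).

(* [J h = (1 - h G)^{-1}], the implicit Euler step for the generator [G]. *)
Definition euler_step (h : R) (u : X) : X := scal (/ h) (S (/ h) u).
Local Notation J := euler_step.

(** The resolvent identity is compared with the one obtained by exchanging the parameters, and the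
    factor [mu - lam] is cancelled. *)
Lemma S_comm lam mu u : 0 < lam -> 0 < mu -> S lam (S mu u) = S mu (S lam u).
Proof.
  intros hl hm. destruct (Req_dec lam mu) as [->|hne]; trivial.
  pose proof (hS_res u hl hm) as h1. pose proof (hS_res u hm hl) as h2.
  assert (h3 : scal (mu - lam) (S lam (S mu u)) = scal (mu - lam) (S mu (S lam u))).
  { replace (scal (mu - lam) (S lam (S mu u))) with
      (minus (plus (S mu u) (scal (mu - lam) (S lam (S mu u)))) (S mu u)) by vec.
    rewrite <- h1. rewrite h2 at 1. vec. }
  replace (S lam (S mu u)) with (scal (/ (mu - lam)) (scal (mu - lam) (S lam (S mu u))))
    by (vec; field; lra).
  rewrite h3. vec. field. lra.
Qed.

Lemma op_J h : 0 < h -> positive_op P 1 (J h).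
Proof.
  intros hh. assert (hi : 0 < / h) by now apply Rinv_0_lt_compat.
  replace 1 with (/ h * / / h) by (field; lra).
  apply (op_scale hX (Rlt_le _ _ hi)). now apply hS.
Qed.

Lemma op_S1 : positive_op P 1 (S 1).
Proof. rewrite <- Rinv_1 at 1. apply hS. lra. Qed.

Lemma bound_1 F u : positive_op P 1 F -> norm (F u) <= M * norm u.
Proof. intros hF. rewrite <- (Rmult_1_l M). apply (op_bound hM u Rle_0_1 hF). Qed.

Lemma dist_1 F u v : positive_op P 1 F -> norm (minus (F u) (F v)) <= M * norm (minus u v).
Proof. intros hF. rewrite <- (op_minus _ _ hF). now apply bound_1. Qed.

Lemma J_S1 h v : 0 < h -> J h (S 1 v) = S 1 (J h v).
Proof.
  intros hh. unfold J. rewrite (op_scal op_S1). f_equal. apply S_comm; [|lra].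
  now apply Rinv_0_lt_compat.
Qed.

(* On the domain, [G (S 1 v) = S 1 v - v]. *)
Lemma J_step h v : 0 < h ->
  J h (S 1 v) = plus (S 1 v) (scal h (J h (minus (S 1 v) v))).
Proof.
  intros hh. unfold J. set (lam := / h).
  assert (hl : 0 < lam) by now apply Rinv_0_lt_compat.
  assert (hlh : lam * h = 1) by (unfold lam; field; lra).
  rewrite (op_minus _ _ (hS hl)).
  pose proof (hS_res v Rlt_0_1 hl) as h1. rewrite (S_comm v Rlt_0_1 hl) in h1.
  replace (scal h (scal lam (minus (S lam (S 1 v)) (S lam v)))) with
    (scal (lam * h) (minus (S lam (S 1 v)) (S lam v))) by vec.
  rewrite hlh. rewrite h1 at 2. vec.
Qed.

Lemma norm_G v : norm (minus (S 1 v) v) <= (M + 1) * norm v.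
Proof.
  eapply Rle_trans; [apply norm_minus_le|]. pose proof (bound_1 v op_S1). lra.
Qed.

Lemma J_dist h v : 0 < h -> norm (minus (J h (S 1 v)) (S 1 v)) <= h * M * norm (minus (S 1 v) v).
Proof.
  intros hh. rewrite (J_step v hh).
  replace (minus (plus (S 1 v) (scal h (J h (minus (S 1 v) v)))) (S 1 v))
    with (scal h (J h (minus (S 1 v) v))) by vec.
  rewrite norm_scal_nonneg by lra. rewrite Rmult_assoc.
  apply Rmult_le_compat_l; [lra|]. now apply bound_1, op_J.
Qed.

Lemma J_iter_dist h n v : 0 < h ->
  norm (minus (Nat.iter n (J h) (S 1 v)) (S 1 v)) <= INR n * h * M * norm (minus (S 1 v) v).
Proof.
  intros hh. induction n as [|n IH].
  - simpl. rewrite minus_self, norm_of_zero. lra.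
  (* Peeling off the innermost step puts a whole power of [J h] on the increment, so each step costs
     one factor [M]. *)
  - rewrite Nat.iter_succ_r, S_INR.
    pose proof (norm_minus_trans (Nat.iter n (J h) (S 1 v))
      (Nat.iter n (J h) (J h (S 1 v))) (S 1 v)) as h1.
    pose proof (op_iter_one n (op_J hh)) as hn.
    rewrite <- (op_minus _ _ hn) in h1.
    assert (hs : minus (J h (S 1 v)) (S 1 v) = scal h (J h (minus (S 1 v) v))).
    { rewrite (J_step v hh). vec. }
    rewrite hs, (op_scal hn), norm_scal_nonneg in h1 by lra.
    pose proof (bound_1 (minus (S 1 v) v) (op_iter_one (Datatypes.S n) (op_J hh))) as h2.
    cbv beta in h2. rewrite Nat.iter_succ_r in h2.
    apply (Rmult_le_compat_l h) in h2; lra.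
Qed.

(** Only the elapsed time [n h] matters, whatever the step. On the range of [S 1] this is
    [J_iter_dist]; density and the common bound [M] extend it to every vector. *)
Lemma J_orbit y eps : 0 < eps -> exists delta, 0 < delta /\
  forall h n, 0 < h -> INR n * h < delta -> norm (minus (Nat.iter n (J h) y) y) <= eps.
Proof.
  intros he. destruct (@hS_dense y (eps / (2 * (M + 1)))) as [v hv].
  { apply Rdiv_lt_0_compat; lra. }
  pose proof (norm_ge_0 (minus (S 1 v) v)) as hg0.
  set (g := norm (minus (S 1 v) v)) in *.
  assert (hc : 0 < M * (g + 1)) by (apply Rmult_lt_0_compat; lra).
  exists (eps / 2 / (M * (g + 1))). split; [apply Rdiv_lt_0_compat; lra|].
  intros h n hh hn.
  assert (hv' : (M + 1) * norm (minus y (S 1 v)) <= eps / 2).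
  { apply (Rmult_lt_compat_l (M + 1)) in hv; [|lra].
    replace ((M + 1) * (eps / (2 * (M + 1)))) with (eps / 2) in hv by (field; lra). lra. }
  assert (hn' : INR n * h * (M * (g + 1)) <= eps / 2).
  { apply (Rmult_lt_compat_r (M * (g + 1))) in hn; trivial.
    replace (eps / 2 / (M * (g + 1)) * (M * (g + 1))) with (eps / 2) in hn by (field; lra).
    lra. }
  pose proof (norm_minus_trans (Nat.iter n (J h) (S 1 v)) (Nat.iter n (J h) y) y) as h1.
  pose proof (norm_minus_trans (S 1 v) (Nat.iter n (J h) (S 1 v)) y) as h2.
  pose proof (dist_1 y (S 1 v) (op_iter_one n (op_J hh))) as h3.
  pose proof (J_iter_dist n v hh) as h4. fold g in h4.
  rewrite (norm_minus_sym (S 1 v) y) in h2.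
  assert (h5 : 0 <= INR n * h * M).
  { repeat apply Rmult_le_pos; try lra. apply pos_INR. }
  nra.
Qed.

Lemma J_id_tends u : tends (fun n => J ((/ 2) ^ n) u) u.
Proof.
  apply tends_eps. intros eps he. destruct (@J_orbit u (eps / 2)) as (d & hd & h); [lra|].
  destruct (inv2_pow_small hd) as [N hN]. exists N. intros n hn.
  specialize (h ((/ 2) ^ n) 1%nat (inv2_pow_pos n)). specialize (hN n hn).
  simpl in h. specialize (h ltac:(lra)). lra.
Qed.

(** A local error of order [k^2] needs a vector in the domain of [G^2], hence [S 1 (S 1 v)]. With
    [y] the generator there, the error is [k] times a combination of [J (2 k) y - y] (twice),
    [J k y - y] and [J k (J k y) - y], each of order [k]; the constant is [7 = 2 + 2 + 1 + 2]. *)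
Lemma half_step k v : 0 < k ->
  norm (minus (J (2 * k) (S 1 (S 1 v))) (J k (J k (S 1 (S 1 v)))))
  <= 7 * k ^ 2 * (M * (M + 1) ^ 2) * norm v.
Proof.
  intros hk. assert (h2k : 0 < 2 * k) by lra.
  set (v' := minus (S 1 v) v). set (y := S 1 v').
  assert (hy : minus (S 1 (S 1 v)) (S 1 v) = y).
  { unfold y, v'. now rewrite (op_minus _ _ op_S1). }
  assert (h1 : forall h, 0 < h ->
    J h (S 1 (S 1 v)) = plus (S 1 (S 1 v)) (scal h (J h y))).
  { intros h hh. rewrite <- hy. now apply J_step. }
  set (g := norm (minus (S 1 v') v')).
  assert (hg : g <= (M + 1) ^ 2 * norm v).
  { unfold g. eapply Rle_trans; [apply norm_G|]. pose proof (norm_G v) as h.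
    fold v' in h. apply (Rmult_le_compat_l (M + 1)) in h; lra. }
  assert (e1 : norm (minus (J (2 * k) y) y) <= 2 * k * M * g) by now apply J_dist.
  assert (e2 : norm (minus (J k y) y) <= k * M * g) by now apply J_dist.
  assert (e3 : norm (minus (J k (J k y)) y) <= 2 * k * M * g).
  { pose proof (J_iter_dist 2 v' hk) as h. simpl in h. fold g in h. fold y in h. lra. }
  rewrite (h1 (2 * k) h2k), (h1 k hk), (op_plus (op_J hk)), (h1 k hk), (op_scal (op_J hk)).
  replace (minus (plus (S 1 (S 1 v)) (scal (2 * k) (J (2 * k) y)))
    (plus (plus (S 1 (S 1 v)) (scal k (J k y))) (scal k (J k (J k y)))))
    with (scal k (minus (plus (minus (J (2 * k) y) y) (minus (J (2 * k) y) y))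
      (plus (minus (J k y) y) (minus (J k (J k y)) y)))) by vec.
  rewrite norm_scal_nonneg by lra.
  apply Rle_trans with (k * (7 * k * M * g)).
  - apply Rmult_le_compat_l; [lra|]. eapply Rle_trans; [apply norm_minus_le|].
    eapply Rle_trans; [apply Rplus_le_compat; apply norm_plus_le|]. lra.
  - assert (0 <= 7 * k ^ 2 * M) by (repeat apply Rmult_le_pos; try lra; apply pow_le; lra).
    apply (Rmult_le_compat_l (7 * k ^ 2 * M)) in hg; trivial. simpl in *. lra.
Qed.

Lemma iter_double (F : X -> X) m u :
  Nat.iter (2 * m) F u = Nat.iter m (fun z => F (F z)) u.
Proof.
  induction m as [|m IH]; trivial.
  replace (2 * Datatypes.S m)%nat with (Datatypes.S (Datatypes.S (2 * m))) by lia.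
  simpl Nat.iter. rewrite <- IH. reflexivity.
Qed.

(** The difference of the two powers telescopes into [m] local errors. As the steps commute with
    [S 1], the orbit keeps the form [S 1 (S 1 _)] over the orbit of [v], so one bound [b] on the
    latter controls every local error. *)
Lemma half_step_iter k m v b : 0 < k ->
  (forall j, norm (Nat.iter j (fun z => J k (J k z)) v) <= b) ->
  norm (minus (Nat.iter m (J (2 * k)) (S 1 (S 1 v)))
    (Nat.iter m (fun z => J k (J k z)) (S 1 (S 1 v))))
  <= INR m * (M * (7 * k ^ 2 * (M * (M + 1) ^ 2) * b)).
Proof.
  intros hk. assert (h2k : 0 < 2 * k) by lra.
  revert v; induction m as [|m IH]; intros v hb.
  - simpl. rewrite minus_self, norm_of_zero. lra.
  - rewrite !Nat.iter_succ_r, S_INR.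
    assert (hQ : J k (J k (S 1 (S 1 v))) = S 1 (S 1 (J k (J k v)))) by now rewrite !J_S1.
    pose proof (norm_minus_trans (Nat.iter m (J (2 * k)) (J k (J k (S 1 (S 1 v)))))
      (Nat.iter m (J (2 * k)) (J (2 * k) (S 1 (S 1 v))))
      (Nat.iter m (fun z => J k (J k z)) (J k (J k (S 1 (S 1 v)))))) as h1.
    pose proof (dist_1 (J (2 * k) (S 1 (S 1 v))) (J k (J k (S 1 (S 1 v))))
      (op_iter_one m (op_J h2k))) as h2.
    pose proof (half_step v hk) as h3.
    assert (h4 : norm v <= b) by exact (hb O).
    assert (hc : 0 <= 7 * k ^ 2 * (M * (M + 1) ^ 2)).
    { repeat apply Rmult_le_pos; try lra; apply pow_le; lra. }
    apply (Rmult_le_compat_l (7 * k ^ 2 * (M * (M + 1) ^ 2))) in h4; trivial.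
    assert (h5 := Rle_trans _ _ _ h3 h4). apply (Rmult_le_compat_l M) in h5; [|lra].
    specialize (IH (J k (J k v))). rewrite <- hQ in IH.
    assert (h6 : forall j, norm (Nat.iter j (fun z => J k (J k z)) (J k (J k v))) <= b).
    { intros j. pose proof (hb (Datatypes.S j)) as h. now rewrite Nat.iter_succ_r in h. }
    specialize (IH h6). lra.
Qed.

Definition euler_orbit (n : nat) (t : R) (u : X) : X :=
  Nat.iter (dyadic_floor t n) (J ((/ 2) ^ n)) u.

Lemma op_euler_orbit n t : positive_op P 1 (euler_orbit n t).
Proof. apply op_iter_one. apply op_J. apply inv2_pow_pos. Qed.

Lemma euler_orbit_S t v : 0 <= t -> exists C, forall n,
  norm (minus (euler_orbit (Datatypes.S n) t (S 1 (S 1 v))) (euler_orbit n t (S 1 (S 1 v))))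
  <= C * (/ 2) ^ n.
Proof.
  intros ht. set (g := norm (minus (S 1 (S 1 v)) (S 1 v))).
  set (A := M * (7 * (M * (M + 1) ^ 2) * (M * norm v))).
  pose proof (norm_ge_0 v) as hv0.
  assert (hA : 0 <= A).
  { unfold A. repeat apply Rmult_le_pos; try lra; apply pow_le; lra. }
  assert (hg0 : 0 <= g) by apply norm_ge_0.
  (* [t * A] collects the local errors of at most [t / h] coarse steps; [M * M * g] pays for the
     possible extra fine step. *)
  exists (t * A + M * M * g). intros n.
  pose proof (inv2_pow_pos n) as hh. set (h := (/ 2) ^ n) in *.
  set (k := (/ 2) ^ (Datatypes.S n)).
  assert (hk : 0 < k) by apply inv2_pow_pos.
  assert (h2k : h = 2 * k) by (unfold h, k; simpl; field).
  destruct (dyadic_floor_S n ht) as (e & he & hfl). unfold euler_orbit.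
  fold k h. rewrite hfl.
  set (m := dyadic_floor t n). set (x := S 1 (S 1 v)).
  assert (hmt : INR m * h <= t) by apply (dyadic_floor_time n ht).
  pose proof (op_J hk) as oJ.
  assert (e1 : norm (minus (Nat.iter (e + 2 * m) (J k) x) (Nat.iter (2 * m) (J k) x))
    <= M * M * g * h).
  { rewrite Nat.add_comm, Nat.iter_add.
    eapply Rle_trans; [apply (dist_1 _ _ (op_iter_one (2 * m) oJ))|].
    assert (hek : INR e * k <= h).
    { assert (INR e <= 1) by (apply (le_INR e 1); easy). pose proof (pos_INR e). nra. }
    pose proof (J_iter_dist e (S 1 v) hk) as h1. fold g in h1.
    fold x in h1. replace (M * M * g * h) with (M * (h * (M * g))) by ring.
    apply Rmult_le_compat_l; [lra|].
    assert (0 <= M * g) by (apply Rmult_le_pos; lra).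
    apply (Rmult_le_compat_r (M * g)) in hek; trivial. lra. }
  assert (e2 : norm (minus (Nat.iter (2 * m) (J k) x) (Nat.iter m (J h) x)) <= t * A * h).
  { rewrite norm_minus_sym, iter_double, h2k.
    eapply Rle_trans; [apply (@half_step_iter k m v (M * norm v) hk)|].
    - intros j. rewrite <- iter_double. apply bound_1. now apply op_iter_one.
    - rewrite <- h2k. replace (INR m * (M * (7 * k ^ 2 * (M * (M + 1) ^ 2) * (M * norm v))))
        with (INR m * h * (k / 2 * A)) by (unfold A; rewrite h2k; field).
      replace (t * A * h) with (t * (h * A)) by ring.
      apply Rmult_le_compat; trivial.
      + apply Rmult_le_pos; [apply pos_INR|lra].
      + apply Rmult_le_pos; lra.
      + apply Rmult_le_compat_r; lra. }
  pose proof (norm_minus_trans (Nat.iter (2 * m) (J k) x) (Nat.iter (e + 2 * m) (J k) x)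
    (Nat.iter m (J h) x)).
  lra.
Qed.

Lemma geometric_tends (z : nat -> X) C :
  (forall n, norm (minus (z (Datatypes.S n)) (z n)) <= C * (/ 2) ^ n) ->
  exists l, tends z l.
Proof.
  intros h. assert (hC : 0 <= C).
  { specialize (h O). pose proof (norm_ge_0 (minus (z 1%nat) (z O))). simpl in h. lra. }
  apply cauchy_tends_tail with (fun n => 2 * C * (/ 2) ^ n).
  - assert (key : forall n m, (n <= m)%nat ->
      norm (minus (z m) (z n)) <= 2 * C * (/ 2) ^ n - 2 * C * (/ 2) ^ m).
    { intros n m hnm. induction hnm as [|m hnm IH].
      - rewrite minus_self, norm_of_zero. lra.
      - pose proof (norm_minus_trans (z m) (z (Datatypes.S m)) (z n)).
        specialize (h m). simpl. lra. }
    intros n m hnm. specialize (key n m hnm). pose proof (inv2_pow_pos m).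
    assert (0 <= 2 * C * (/ 2) ^ m) by (repeat apply Rmult_le_pos; lra). lra.
  - apply tends_geom. lra.
Qed.

Lemma dense_S1_S1 u eps : 0 < eps -> exists v, norm (minus u (S 1 (S 1 v))) < eps.
Proof.
  intros he. destruct (@hS_dense u (eps / 2)) as [y hy]; [lra|].
  destruct (@hS_dense y (eps / (2 * M))) as [v hv]; [apply Rdiv_lt_0_compat; lra|].
  exists v. pose proof (norm_minus_trans (S 1 y) u (S 1 (S 1 v))).
  pose proof (dist_1 y (S 1 v) op_S1).
  apply (Rmult_lt_compat_l M) in hv; [|lra].
  replace (M * (eps / (2 * M))) with (eps / 2) in hv by (field; lra). lra.
Qed.

(** * The limit semigroup and its generator *)

Definition generated (t : R) (u : X) : X := vlim (fun n => euler_orbit n t u).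

Lemma generated_tends t u : 0 <= t -> tends (fun n => euler_orbit n t u) (generated t u).
Proof.
  intros ht. apply vlim_correct. apply cauchy_tends. intros eps he.
  destruct (@dense_S1_S1 u (eps / (4 * M))) as [v hv]; [apply Rdiv_lt_0_compat; lra|].
  apply (Rmult_lt_compat_l M) in hv; [|lra].
  replace (M * (eps / (4 * M))) with (eps / 4) in hv by (field; lra).
  destruct (@euler_orbit_S t v ht) as [C hC].
  destruct (geometric_tends hC) as [l hl].
  set (x := S 1 (S 1 v)) in *.
  destruct (proj1 (tends_eps _ l) hl (eps / 4)) as [N hN]; [lra|].
  assert (key : forall n, (N <= n)%nat -> norm (minus (euler_orbit n t u) l) < eps / 2).
  { intros n hn. specialize (hN n hn).
    pose proof (norm_minus_trans (euler_orbit n t x) (euler_orbit n t u) l).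
    pose proof (dist_1 u x (op_euler_orbit n t)). lra. }
  exists N. intros n m hn hm.
  pose proof (norm_minus_trans l (euler_orbit n t u) (euler_orbit m t u)).
  rewrite (norm_minus_sym l) in H.
  pose proof (key n hn). pose proof (key m hm). lra.
Qed.

Lemma op_generated t : 0 <= t -> positive_op P 1 (generated t).
Proof.
  intros ht. apply (op_limit hX (fun n => op_euler_orbit n t)).
  intros u. now apply generated_tends.
Qed.

(** The step counts for [s] and [t] add up to that for [s + t] except for a carry [e <= 1]. The
    extra Euler step is placed innermost, on the fixed vector [u], where it tends to the
    identity. *)
Lemma generated_add s t u : 0 <= s -> 0 <= t ->
  generated (s + t) u = generated s (generated t u).
Proof.
  intros hs ht. assert (hst : 0 <= s + t) by lra.
  apply (tends_unique (@generated_tends (s + t) u hst)).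
  apply tends_squeeze with (fun n =>
    M * (M * norm (minus (J ((/ 2) ^ n) u) u)
      + norm (minus (euler_orbit n t u) (generated t u)))
    + norm (minus (euler_orbit n s (generated t u)) (generated s (generated t u)))).
  - intros n. unfold euler_orbit at 1.
    destruct (@dyadic_floor_add s t n hs ht) as (e & he & ->).
    rewrite !Nat.iter_add. pose proof (inv2_pow_pos n) as hh. set (h := (/ 2) ^ n) in *.
    change (norm (minus (euler_orbit n s (euler_orbit n t (Nat.iter e (J h) u)))
      (generated s (generated t u))) <= M * (M * norm (minus (J h u) u)
      + norm (minus (euler_orbit n t u) (generated t u)))
      + norm (minus (euler_orbit n s (generated t u)) (generated s (generated t u)))).
    assert (h0 : norm (minus (Nat.iter e (J h) u) u) <= norm (minus (J h u) u)).
    { destruct e as [|[|e]]; [|simpl; lra|lia]. simpl. rewrite minus_self, norm_of_zero.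
      apply norm_ge_0. }
    pose proof (norm_minus_trans (euler_orbit n s (generated t u))
      (euler_orbit n s (euler_orbit n t (Nat.iter e (J h) u))) (generated s (generated t u))) as h1.
    pose proof (dist_1 (euler_orbit n t (Nat.iter e (J h) u)) (generated t u)
      (op_euler_orbit n s)) as h2.
    pose proof (norm_minus_trans (euler_orbit n t u)
      (euler_orbit n t (Nat.iter e (J h) u)) (generated t u)) as h3.
    pose proof (dist_1 (Nat.iter e (J h) u) u (op_euler_orbit n t)) as h4.
    apply (Rmult_le_compat_l M) in h0; [|lra].
    assert (h5 : norm (minus (euler_orbit n t (Nat.iter e (J h) u)) (generated t u))
      <= M * norm (minus (J h u) u) + norm (minus (euler_orbit n t u) (generated t u))) by lra.
    apply (Rmult_le_compat_l M) in h5; lra.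
  - replace 0 with (M * (M * 0 + 0) + 0) by ring.
    apply is_lim_seq_plus'; [|apply tends_norm; now apply generated_tends].
    apply (is_lim_seq_scal_l _ M (M * 0 + 0)).
    apply is_lim_seq_plus'; [|apply tends_norm; now apply generated_tends].
    apply (is_lim_seq_scal_l _ M 0). apply tends_norm. apply J_id_tends.
Qed.

Lemma generated_0 u : generated 0 u = u.
Proof.
  apply (tends_unique (@generated_tends 0 u (Rle_refl 0))).
  apply (tends_ext (x := fun _ => u)); [|apply tends_const].
  intros n. unfold euler_orbit. now rewrite dyadic_floor_0.
Qed.

Lemma generated_continuous u eps : 0 < eps -> exists delta, 0 < delta /\
  forall t, 0 < t < delta -> norm (minus (generated t u) u) <= eps.
Proof.
  intros he. destruct (J_orbit u he) as (d & hd & h). exists d. split; trivial.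
  intros t ht. assert (ht0 : 0 <= t) by lra.
  apply (tends_minus_norm_le (@generated_tends t u ht0)). intros n.
  apply h; [apply inv2_pow_pos|]. pose proof (dyadic_floor_time n ht0). lra.
Qed.

Lemma generated_substochastic : is_substochastic P generated.
Proof.
  split; [split| |].
  - intros t ht. pose proof (op_generated ht) as hW. split.
    + exact (op_plus hW).
    + exact (op_scal hW).
    + exists M. split; [lra|]. intros u. now apply bound_1.
  - exact generated_0.
  - intros s t hs ht u. now apply generated_add.
  - intros u. apply (filterlim_norm_eps (filter_filter (F := at_right 0))).
    intros eps he. destruct (@generated_continuous u (eps / 2)) as (d & hd & h); [lra|].
    apply at_right_0. exists d. split; trivial. intros t ht. specialize (h t ht).
    change (norm (minus (generated t u) u) < eps). lra.
  - intros t ht u. apply (op_pos (op_generated ht)).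
  - intros t ht u hu. pose proof (op_norm (op_generated ht) hu). lra.
Qed.

Lemma dyadic_time_tends t y : 0 <= t ->
  tends (fun n => scal (INR (dyadic_floor t n) * (/ 2) ^ n) y) (scal t y).
Proof.
  intros ht. apply tends_squeeze with (fun n => norm y * (/ 2) ^ n).
  - intros n. rewrite norm_minus_sym.
    pose proof (dyadic_floor_time n ht) as h. set (s := INR (dyadic_floor t n) * (/ 2) ^ n) in *.
    replace (minus (scal t y) (scal s y)) with (scal (t - s) y) by vec.
    rewrite norm_scal_nonneg by lra. rewrite Rmult_comm.
    apply Rmult_le_compat_l; [apply norm_ge_0|lra].
  - apply tends_geom. lra.
Qed.

(** For [m] Euler steps of size [h], the increment of the orbit of [S 1 v] is exactly [h] times the
    sum of the [J^j y], [1 <= j <= m], with [y] the expected generator value. Since [m h <= t],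
    [J_orbit] keeps every term near [y], uniformly in the mesh. *)
Lemma generated_generator_S1 v : is_gen generated (S 1 v) (minus (S 1 v) v).
Proof.
  apply is_gen_right_derivative. intros eps he. set (y := minus (S 1 v) v).
  destruct (J_orbit y he) as (d & hd & horb). exists d. split; trivial.
  intros t ht. assert (ht0 : 0 <= t) by lra.
  apply (tends_norm_le (x := fun n => minus (minus (euler_orbit n t (S 1 v)) (S 1 v))
    (scal (INR (dyadic_floor t n) * (/ 2) ^ n) y))).
  - apply tends_minus; [|now apply dyadic_time_tends].
    apply tends_minus; [now apply generated_tends|apply tends_const].
  - intros n. pose proof (dyadic_floor_time n ht0) as htn.
    pose proof (inv2_pow_pos n) as hh. unfold euler_orbit.
    set (h := (/ 2) ^ n) in *. set (m := dyadic_floor t n) in *.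
    pose proof (op_J hh) as oJ.
    assert (hstep : minus (S 1 v) (J h (S 1 v)) = scal (- h) (J h y)).
    { rewrite (J_step v hh). fold y. vec. }
    pose proof (psum_diff m (S 1 v) oJ) as hd'. rewrite hstep in hd'.
    rewrite (op_scal (op_psum hX m Rle_0_1 oJ)) in hd'.
    replace (minus (minus (Nat.iter m (J h) (S 1 v)) (S 1 v)) (scal (INR m * h) y))
      with (minus (scal (-1) (minus (S 1 v) (Nat.iter m (J h) (S 1 v)))) (scal (INR m * h) y))
      by vec.
    rewrite <- hd'.
    replace (minus (scal (-1) (scal (- h) (psum (J h) m (J h y)))) (scal (INR m * h) y))
      with (scal h (minus (psum (J h) m (J h y)) (scal (INR m) y))) by vec.
    rewrite norm_scal_nonneg by lra.
    assert (hav : norm (minus (psum (J h) m (J h y)) (scal (INR m) y)) <= INR m * eps).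
    { apply psum_average. intros j hj. rewrite <- Nat.iter_succ_r.
      apply horb; trivial. apply le_INR in hj. nra. }
    apply (Rmult_le_compat_l h) in hav; [|lra]. nra.
Qed.

(** The resolvent identity rewrites [S lam u] as a value of [S 1], which reduces the claim to
    [lam = 1]. *)
Lemma generated_generator lam u : 0 < lam ->
  is_gen generated (S lam u) (minus (scal lam (S lam u)) u).
Proof.
  intros hl. set (v := plus u (scal (1 - lam) (S lam u))).
  assert (h : S lam u = S 1 v).
  { unfold v. rewrite (op_plus op_S1), (op_scal op_S1), <- S_comm by lra.
    apply hS_res; lra. }
  pose proof (@generated_generator_S1 v) as hg. rewrite <- h in hg.
  replace (minus (scal lam (S lam u)) u) with (minus (S lam u) v) by (unfold v; vec).
  exact hg.
Qed.

Lemma generated_invariant (C : X -> Prop) : closed C ->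
  (forall mu u, 0 < mu -> C u -> C (scal mu (S mu u))) ->
  forall t u, 0 <= t -> C u -> C (generated t u).
Proof.
  intros hC hinv t u ht hu.
  apply (closed_tends (x := fun n => euler_orbit n t u) hC); [|now apply generated_tends].
  intros n. unfold euler_orbit. induction (dyadic_floor t n) as [|m IH]; trivial.
  simpl. apply hinv; trivial. apply Rinv_0_lt_compat, inv2_pow_pos.
Qed.

End Generation.

(** * The minimal semigroup *)

Section Ideal.
Import VectorOperations.
Context (X : RBanach) (P : X -> Prop) (hX : is_abstract_state_space P).
Context (C : X -> Prop) (hC : is_subcone P C) (hher : is_hereditary P C).
Implicit Types (u v w : X).

Lemma subcone_hereditary u v : P u -> P (minus v u) -> C v -> C u.
Proof.
  intros hu huv hv. refine (hher _ huv hv). unfold ole.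
  now replace (minus u zero) with u by vec.
Qed.

Lemma cone_diff_inter u : cone_diff C u /\ P u <-> C u.
Proof.
  destruct hC as [(h0 & hplus & _) hCP]. split.
  - intros [(v & w & hv & hw & hu) hPu]. apply (@subcone_hereditary u v); trivial.
    rewrite hu. replace (minus v (minus v w)) with w by vec. now apply hCP.
  - intros hu. split; [|now apply hCP]. exists u, zero. repeat split; trivial. vec.
Qed.

Lemma cone_diff_order_ideal : is_order_ideal P (cone_diff C).
Proof.
  destruct hC as [(h0 & hplus & hscal) hCP]. split; [split; [|split]|].
  - exists zero, zero. repeat split; trivial. vec.
  - intros u v (u1 & u2 & h1 & h2 & ->) (v1 & v2 & k1 & k2 & ->).
    exists (plus u1 v1), (plus u2 v2). repeat split; try now apply hplus. vec.
  - intros c u (u1 & u2 & h1 & h2 & ->). destruct (Rle_dec 0 c) as [hc|hc].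
    + exists (scal c u1), (scal c u2). repeat split; try now apply hscal. vec.
    + exists (scal (- c) u2), (scal (- c) u1).
      repeat split; try (apply hscal; trivial; lra). vec.
  - intros u1 u2 v (a & b & ha & hb & hu1) (c & d & hc & hd & hu2) h1 h2.
    (* From [u1 = a - b] and [u2 = c - d], one gets [0 <= v + b = (v - u1) + a] and
       [v + b <= c + b]; heredity then puts [v + b] in the cone. *)
    exists (plus v b), b. repeat split; trivial; [|vec].
    apply (@subcone_hereditary _ (plus c b)).
    + replace (plus v b) with (plus (minus v u1) a) by (rewrite hu1; vec).
      apply (cone_plus hX); trivial. now apply hCP.
    + replace (minus (plus c b) (plus v b)) with (plus (minus u2 v) d) by (rewrite hu2; vec).
      apply (cone_plus hX); trivial. now apply hCP.
    + now apply hplus.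
Qed.

End Ideal.

Section MinimalSemigroup.
Import VectorOperations.
Context (X : RBanach) (P : X -> Prop) (Psi : X -> R)
  (U : R -> X -> X) (B : X -> X) (V : R -> X -> X).
Context (hX : is_abstract_state_space P) (hPsi : is_norm_functional P Psi)
  (hU : is_substochastic P U) (hB : is_positive_operator_on P (gen_dom U) B)
  (hAB : forall u : X, gen_dom U u -> P u -> Psi (plus (gen U u) (B u)) <= 0)
  (hV : is_minimal_semigroup P U B V).
Context (M : R) (hM1 : 1 <= M) (hM : forall u : X, cone_cost P (M * norm u) u).
Implicit Types (u v w : X) (lam mu : R).

Definition BL lam u : X := B (resolvent U lam u).

Let L := resolvent U.
Let K := BL.

Lemma resolvent_in_dom lam u : 0 < lam -> gen_dom U (L lam u).
Proof. intros hl. eexists. exact (@is_gen_resolvent X P hX M hM1 hM U hU lam hl u). Qed.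

Lemma gen_resolvent lam u : 0 < lam -> gen U (L lam u) = minus (scal lam (L lam u)) u.
Proof. intros hl. exact (gen_correct (@is_gen_resolvent X P hX M hM1 hM U hU lam hl u)). Qed.

Lemma op_L lam : 0 < lam -> positive_op P (/ lam) (L lam).
Proof. exact (fun hl => op_resolvent hX hM1 hM hU hl). Qed.

(** This is [hAB] at [L lam u], where the generator of [U] takes the value [lam (L lam u) - u] and
    [Psi] is the norm of all the vectors involved. *)
Lemma L_K_norm lam u : 0 < lam -> P u -> lam * norm (L lam u) + norm (K lam u) <= norm u.
Proof.
  intros hl hu. assert (hLu : P (L lam u)) by now apply (op_pos (op_L hl)).
  assert (hd : gen_dom U (L lam u)) by now apply resolvent_in_dom.
  assert (hKu : P (K lam u)) by now apply (pos_op_positive hB).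
  pose proof (hAB hd hLu) as h. rewrite gen_resolvent in h by easy.
  rewrite (Psi_plus hPsi), (Psi_minus hPsi), (Psi_scal hPsi) in h.
  change (B (L lam u)) with (K lam u) in h.
  rewrite !(Psi_norm hPsi) in h by trivial. lra.
Qed.

Lemma op_K lam : 0 < lam -> positive_op P 1 (K lam).
Proof.
  intros hl. pose proof (op_L hl) as hL. split.
  - intros u v. unfold K, BL. fold L. rewrite (op_plus hL).
    apply (pos_op_plus hB); now apply resolvent_in_dom.
  - intros r u. unfold K, BL. fold L. rewrite (op_scal hL).
    apply (pos_op_scal hB); now apply resolvent_in_dom.
  - intros u hu. apply (pos_op_positive hB); [now apply resolvent_in_dom|].
    now apply (op_pos hL).
  - intros u hu. pose proof (L_K_norm hl hu).
    assert (0 <= lam * norm (L lam u)).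
    { apply Rmult_le_pos; [lra|apply norm_ge_0]. }
    lra.
Qed.

Lemma L_res lam mu u : 0 < lam -> 0 < mu ->
  L lam u = plus (L mu u) (scal (mu - lam) (L lam (L mu u))).
Proof.
  intros hl hm. pose proof (op_L hl) as hL.
  pose proof (resolvent_unique hX hM1 hM hU hl
    (@is_gen_resolvent X P hX M hM1 hM U hU mu hm u)) as h.
  change (L lam (minus (scal lam (L mu u)) (minus (scal mu (L mu u)) u)) = L mu u) in h.
  rewrite !(op_minus _ _ hL), !(op_scal hL) in h. symmetry. rewrite <- h at 1. vec.
Qed.

Lemma K_res lam mu u : 0 < lam -> 0 < mu ->
  K lam u = plus (K mu u) (scal (mu - lam) (K lam (L mu u))).
Proof.
  intros hl hm. unfold K, BL. fold L. rewrite (L_res u hl hm).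
  rewrite <- (pos_op_scal hB) by now apply resolvent_in_dom.
  apply (pos_op_plus hB); [now apply resolvent_in_dom|].
  rewrite <- (op_scal (op_L hl)). now apply resolvent_in_dom.
Qed.

(** * The competing semigroup and the resolvent of [V] *)

Let S := pseries L K.

Lemma op_S lam : 0 < lam -> positive_op P (/ lam) (S lam).
Proof. exact (op_pseries hX op_L op_K L_K_norm (lam := lam)). Qed.

Lemma S_res lam mu u : 0 < lam -> 0 < mu ->
  S lam u = plus (S mu u) (scal (mu - lam) (S lam (S mu u))).
Proof. exact (@pseries_res X P hX M hM L K op_L op_K L_K_norm L_res K_res lam mu u). Qed.

(** The range of [S lam] thus contains the domain of the generator of [U], which yields both the
    density of that range and the extension property of [W]. *)
Lemma S_diff lam u : 0 < lam -> S lam (minus u (K lam u)) = L lam u.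
Proof.
  intros hl. rewrite (op_minus _ _ (op_S hl)). unfold S.
  rewrite (pseries_step hX op_L op_K L_K_norm u hl) at 1. vec.
Qed.

Lemma S_dense u eps : 0 < eps -> exists v, norm (minus u (S 1 v)) < eps.
Proof.
  intros he. destruct (resolvent_dense hX hM1 hM hU Rlt_0_1 u he) as [z hz].
  exists (minus z (K 1 z)). rewrite S_diff by lra. exact hz.
Qed.

Let W := generated S.

Lemma W_substochastic : is_substochastic P W.
Proof. exact (generated_substochastic hX hM1 hM op_S S_res S_dense). Qed.

Lemma W_generator lam u : 0 < lam -> is_gen W (S lam u) (minus (scal lam (S lam u)) u).
Proof. exact (@generated_generator X P hX M hM1 hM S op_S S_res S_dense lam u). Qed.

(** Write [w = L 1 u = S 1 (u - K 1 u)] with [u = w - A w]. The generator of [W] at [w] is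
    [w - (u - K 1 u)], that is [A w + B w]. *)
Lemma W_extends : generator_extends U B W.
Proof.
  intros w hw. set (v := gen U w). set (u := minus (scal 1 w) v).
  assert (hLu : L 1 u = w).
  { apply (resolvent_unique hX hM1 hM hU Rlt_0_1). now apply gen_is_gen. }
  assert (hg : is_gen W w (plus v (B w))).
  { pose proof (@W_generator 1 (minus u (K 1 u)) Rlt_0_1) as h.
    rewrite S_diff, hLu in h by lra.
    assert (hK : K 1 u = B w) by (unfold K, BL; fold L; now rewrite hLu).
    replace (plus v (B w)) with (minus (scal 1 w) (minus u (K 1 u)))
      by (rewrite hK; unfold u; vec).
    exact h. }
  split; [now exists (plus v (B w))|]. exact (gen_correct hg).
Qed.

(** The only place where the minimality of [V] enters. *)
Lemma V_le_W t u : 0 <= t -> P u -> P (minus (W t u) (V t u)).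
Proof. intros ht. exact (proj2 (proj2 hV) W W_substochastic W_extends t ht u). Qed.

Lemma resolvent_W lam u : 0 < lam -> resolvent W lam u = S lam u.
Proof.
  intros hl.
  pose proof (resolvent_unique hX hM1 hM W_substochastic hl (@W_generator lam u hl)) as h.
  rewrite <- h. f_equal. vec.
Qed.

(** Because [G] extends [A + B], [(lam - G) (L lam v) = v - K lam v]; the resolvent of [V] therefore
    maps [v - K lam v] to [L lam v], and this telescopes along the iterates. *)
Lemma resolvent_V_partial lam n u : 0 < lam ->
  minus (resolvent V lam u) (L lam (psum (K lam) n u))
  = resolvent V lam (Nat.iter n (K lam) u).
Proof.
  intros hl. destruct hV as [hVs [hVe _]].
  pose proof (op_resolvent hX hM1 hM hVs hl) as hR.
  assert (hstep : forall v, minus (resolvent V lam v) (resolvent V lam (K lam v)) = L lam v).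
  { intros v. rewrite <- (op_minus _ _ hR).
    destruct (hVe (L lam v) (resolvent_in_dom v hl)) as [hd hg].
    apply gen_is_gen in hd. rewrite hg, (gen_resolvent v hl) in hd.
    pose proof (resolvent_unique hX hM1 hM hVs hl hd) as h. refine (eq_trans _ h).
    f_equal. unfold K, BL. fold L. vec. }
  induction n as [|n IH]; simpl.
  - rewrite (op_zero (op_L hl)). vec.
  - rewrite (op_plus (op_L hl)), <- (hstep (Nat.iter n (K lam) u)), <- IH. vec.
Qed.

Lemma resolvent_V lam u : 0 < lam -> resolvent V lam u = S lam u.
Proof.
  intros hl. pose proof (proj1 hV) as hVs.
  pose proof (op_resolvent hX hM1 hM hVs hl) as hR.
  apply (op_ext_cone hX hR (op_S hl)). clear u. intros u hu.
  apply (cone_antisym hX).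
  - apply (cone_tends hX (x := fun n => minus (resolvent V lam u) (L lam (psum (K lam) n u)))).
    + intros n. rewrite resolvent_V_partial by easy.
      apply (op_pos hR). exact (op_pos (op_iter_one n (op_K hl)) hu).
    + apply tends_minus; [apply tends_const|].
      exact (@pseries_tends X P hX L K op_L op_K L_K_norm lam u hl).
  - rewrite <- resolvent_W by easy.
    apply (resolvent_mono hX hM1 hM hVs W_substochastic hl); trivial.
    intros t ht v hv. now apply V_le_W.
Qed.

(** * Identification of [Xi] with the limit functional *)

Lemma afun_resolvent lam u : 0 < lam ->
  afun Psi U B (L lam u) = Psi u - Psi (K lam u) - lam * Psi (L lam u).
Proof.
  intros hl. unfold afun. rewrite gen_resolvent by easy.
  change (B (L lam u)) with (K lam u).
  rewrite (Psi_plus hPsi), (Psi_minus hPsi), (Psi_scal hPsi). ring.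
Qed.

Lemma afun_series lam u : 0 < lam ->
  is_series (fun n => afun Psi U B (L lam (Nat.iter n (K lam) u)))
    (Psi u - defect K Psi lam u - lam * Psi (S lam u)).
Proof.
  intros hl.
  change (is_lim_seq (sum_n (fun n => afun Psi U B (L lam (Nat.iter n (K lam) u))))
    (Psi u - defect K Psi lam u - lam * Psi (S lam u))).
  (* [sum_n] up to [n] has [n + 1] terms, whereas [psum] with argument [n] has [n]. *)
  apply (is_lim_seq_ext (fun n => Psi u - Psi (Nat.iter (Datatypes.S n) (K lam) u)
    - lam * Psi (L lam (psum (K lam) (Datatypes.S n) u)))).
  - intros n. symmetry. induction n as [|n IH].
    + rewrite sum_O, afun_resolvent by easy. simpl.
      replace (plus zero u) with u by vec. ring.
    + rewrite sum_Sn, IH, afun_resolvent by easy.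
      change (psum (K lam) (Datatypes.S (Datatypes.S n)) u) with
        (plus (psum (K lam) (Datatypes.S n) u) (Nat.iter (Datatypes.S n) (K lam) u)).
      rewrite (op_plus (op_L hl)), (Psi_plus hPsi).
      change (K lam (Nat.iter (Datatypes.S n) (K lam) u))
        with (Nat.iter (Datatypes.S (Datatypes.S n)) (K lam) u).
      change (Hierarchy.plus ?a ?b) with (a + b). ring.
  - apply is_lim_seq_minus'; [apply is_lim_seq_minus'|].
    + apply is_lim_seq_const.
    + apply (is_lim_seq_incr_1 (fun n => Psi (Nat.iter n (K lam) u))).
      exact (@defect_lim X P hX K op_K Psi hPsi lam u hl).
    + apply (is_lim_seq_scal_l _ lam (Psi (S lam u))).
      apply (is_lim_seq_incr_1 (fun n => Psi (L lam (psum (K lam) n u)))).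
      apply (Psi_tends hPsi (x := fun n => L lam (psum (K lam) n u))).
      exact (@pseries_tends X P hX L K op_L op_K L_K_norm lam u hl).
Qed.

(** With [w] the resolvent of [V] at [u], [a0] gives [Psi u - lam Psi w]. The vector that [abar]
    recovers from [w] is [u] itself, so [afun_series] gives the same quantity minus the defect. *)
Lemma Xi_defect lam u : 0 < lam -> Xi Psi U B V lam u = defect K Psi lam u.
Proof.
  intros hl. pose proof (proj1 hV) as hVs.
  pose proof (gen_correct (@is_gen_resolvent X P hX M hM1 hM V hVs lam hl u)) as hg.
  unfold Xi, a0, abar. cbv zeta. rewrite hg.
  set (w := resolvent V lam u).
  assert (hw : minus (scal lam w) (minus (scal lam w) u) = u) by vec.
  change (- Psi (minus (scal lam w) u) - Series (fun n => afun Psi U B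
    (L lam (Nat.iter n (K lam) (minus (scal lam w) (minus (scal lam w) u)))))
    = defect K Psi lam u).
  rewrite hw. unfold w.
  rewrite (is_series_unique _ _ (@afun_series lam u hl)).
  rewrite (Psi_minus hPsi), (Psi_scal hPsi), resolvent_V by easy. ring.
Qed.

Lemma Hcone_null_cone u : Hcone P Psi U B V u <-> null_cone P K Psi u.
Proof.
  split; intros [hu h]; split; trivial; intros lam hl; specialize (h lam hl).
  - now rewrite <- Xi_defect.
  - now rewrite Xi_defect.
Qed.

Lemma Hcone_closed : closed (Hcone P Psi U B V).
Proof.
  apply (closed_ext (null_cone P K Psi)).
  - intros u. symmetry. apply Hcone_null_cone.
  - exact (null_cone_closed hX hM1 hM op_K hPsi).
Qed.

Lemma Hcone_subcone : is_subcone P (Hcone P Psi U B V).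
Proof.
  destruct (null_cone_is_subcone hX op_K hPsi) as [(h0 & hplus & hscal) hP].
  split; [split; [|split]|].
  - now apply Hcone_null_cone.
  - intros u v hu hv. apply Hcone_null_cone. apply hplus; now apply Hcone_null_cone.
  - intros c u hc hu. apply Hcone_null_cone. apply hscal; trivial. now apply Hcone_null_cone.
  - now intros u [hu _].
Qed.

Lemma Hcone_hereditary : is_hereditary P (Hcone P Psi U B V).
Proof.
  intros u v hu huv hv. apply Hcone_null_cone in hv. apply Hcone_null_cone.
  apply (null_cone_hereditary hX op_K hPsi (v := v)); trivial.
  unfold ole in hu. now replace (minus u zero) with u in hu by vec.
Qed.

Lemma Hcone_invariant t u : 0 <= t -> Hcone P Psi U B V u -> Hcone P Psi U B V (V t u).
Proof.
  intros ht hu. pose proof (proj1 hu) as hPu.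
  apply Hcone_null_cone in hu. apply Hcone_null_cone.
  apply (null_cone_hereditary hX op_K hPsi (v := W t u)).
  - now apply (sub_positive (proj1 hV)).
  - now apply V_le_W.
  - apply (generated_invariant hX hM1 hM op_S S_res S_dense
      (null_cone_closed hX hM1 hM op_K hPsi)); trivial.
    intros mu v hm hv.
    apply (null_cone_is_subcone hX op_K hPsi); [lra|].
    exact (null_cone_pseries hX hM1 hM op_L op_K L_K_norm K_res hPsi hm hv).
Qed.

End MinimalSemigroup.

Theorem theorem3p17
  (X : CompleteNormedModule R_AbsRing) (P : X -> Prop) (Psi : X -> R)
  (U : R -> X -> X) (B : X -> X) (V : R -> X -> X)
  (hX : is_abstract_state_space P)
  (hPsi : is_norm_functional P Psi)
  (hU : is_substochastic P U)
  (hB : is_positive_operator_on P (gen_dom U) B)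
  (hAB : forall u : X, gen_dom U u -> P u -> Psi (plus (gen U u) (B u)) <= 0)
  (hV : is_minimal_semigroup P U B V) :
  let H := Hcone P Psi U B V in
  let HH := cone_diff H in
  (closed H /\ is_subcone P H /\ is_hereditary P H) /\
  (is_order_ideal P HH /\ (forall u : X, HH u /\ P u <-> H u)) /\
  (forall t : R, 0 <= t -> forall u : X, HH u -> HH (V t u)).
Proof.
  destruct (cone_decomposition hX) as (M & hM1 & hM).
  pose proof (Hcone_subcone hX hPsi hU hB hAB hV hM1 hM) as hsub.
  pose proof (Hcone_hereditary hX hPsi hU hB hAB hV hM1 hM) as hher.
  intros H HH. split; [|split; [split|]].
  - split; [|split]; trivial. exact (Hcone_closed hX hPsi hU hB hAB hV hM1 hM).
  - exact (cone_diff_order_ideal hX hsub hher).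
  - exact (cone_diff_inter hsub hher).
  - intros t ht u (v & w & hv & hw & hu).
    exists (V t v), (V t w). split; [|split].
    + exact (Hcone_invariant hX hPsi hU hB hAB hV hM1 hM ht hv).
    + exact (Hcone_invariant hX hPsi hU hB hAB hV hM1 hM ht hw).
    + rewrite hu. exact (op_minus v w (substochastic_op (proj1 hV) ht)).
Qed.
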